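(* Let $G$ be a $3$-regular graph and let $q\ge 2$ be an integer. Then \[ C_q(G)^{1/|V(G)|} \le C_q(K_{3,3})^{1/6}, \] with equality if and only if $G$ is a disjoint union of copies of $K_{3,3}$.
   Context: Graphs are finite, simple and non-empty. For a graph $G$, $C_q(G)$ denotes the number of proper $q$-colorings of $G$, i.e. maps $\sigma:V(G)\to\{1,\dots,q\}$ with $\sigma(u)\ne\sigma(v)$ for every edge $uv$. $K_{3,3}$ is the complete bipartite graph with parts of size $3$. *)

(* Defs.v *)
From mathcomp Require Import all_boot.

Set Implicit Arguments.
Unset Strict Implicit.
Unset Printing Implicit Defensive.

(* The vertex set may be empty: non-emptiness is stated where it is needed. *)
Record sgraph := SGraph {
  vertex :> finType;
  edge : rel vertex;
  edge_sym : symmetric edge;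
  edge_irrefl : irreflexive edge
}.

Definition degree (G : sgraph) (u : G) : nat := #|[set v | edge u v]|.

Definition regular (d : nat) (G : sgraph) : Prop :=
  forall u : G, degree u = d.

Definition isomorphic (G H : sgraph) : Prop :=
  exists2 f : G -> H, bijective f & {mono f : u v / edge u v}.

Definition proper_coloring (G : sgraph) (q : nat) (f : {ffun G -> 'I_q}) : bool :=
  [forall u, forall v, edge u v ==> (f u != f v)].

Definition num_colorings (q : nat) (G : sgraph) : nat :=
  #|[set f : {ffun G -> 'I_q} | proper_coloring f]|.

Definition bip_edge (m n : nat) : rel ('I_m + 'I_n)%type := fun x y =>
  match x, y with
  | inl _, inr _ | inr _, inl _ => true
  | _, _ => false
  end.

Lemma bip_edge_sym m n : symmetric (@bip_edge m n).
Proof. by case=> [x|x] [y|y]. Qed.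

Lemma bip_edge_irrefl m n : irreflexive (@bip_edge m n).
Proof. by case. Qed.

Definition complete_bipartite (m n : nat) : sgraph :=
  SGraph (@bip_edge_sym m n) (@bip_edge_irrefl m n).

Definition copies_edge (k : nat) (H : sgraph) : rel ('I_k * H)%type :=
  fun x y => (x.1 == y.1) && edge x.2 y.2.

Lemma copies_edge_sym k H : symmetric (@copies_edge k H).
Proof. by move=> x y; rewrite /copies_edge eq_sym edge_sym. Qed.

Lemma copies_edge_irrefl k H : irreflexive (@copies_edge k H).
Proof. by move=> x; rewrite /copies_edge edge_irrefl andbF. Qed.

Definition disjoint_copies (k : nat) (H : sgraph) : sgraph :=
  SGraph (@copies_edge_sym k H) (@copies_edge_irrefl k H).

Definition is_union_of_copies (H G : sgraph) : Prop :=
  exists k : nat, isomorphic G (disjoint_copies k H).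

(* Main.v *)
From Stdlib Require Import BinNat Nnat.
Require Import Defs.
From mathcomp Require Import all_boot all_order all_algebra.
From mathcomp Require Import reals exp.
From mathcomp Require Import ring lra zify.

(* For [q = 2] a colouring of a component is determined by its value at one vertex,
   and a bipartite cubic component has at least six vertices, with equality only
   for [K_{3,3}].

   For [q >= 3] take a maximum cut [(A, B)]; both sides induce matchings.  Once [A]
   is coloured, the components of [B] (vertices and edges) are coloured
   independently, so the number of colourings is a sum, over the proper colourings
   of [A], of a product of functions of at most four colours.  Apply Hoelder's
   inequality with exponent [3], one vertex or one edge of [A] at a time: an
   unmatched vertex of [A] occurs in three factors.  An edge of [A] may occur in
   four, but then two depend on one end and two on the other, and the required
   bound is the [L^{3/2} -> L^3] norm of the kernel [x != y], which is attained by
   constants once [q >= 3].  What remains is the third moment of each factor.  Let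
   [theta ^ 9 = C_q(K_{3,3}) / q^6] be the probability that a random colouring of
   [K_{3,3}] is proper.  A vertex of [B] with its three edges contributes at most
   [theta ^ 3], an edge of [B] with its four adjacent edges at most [theta ^ 5], and
   an edge of [A] the factor [1 - 1/q < theta].  Exchanging [A] and [B] if necessary,
   the inequality is strict unless [G] is bipartite; and then equality in Hoelder's
   inequality forces the neighbours of a vertex to have the same neighbourhood. *)

Set Implicit Arguments.
Unset Strict Implicit.
Unset Printing Implicit Defensive.
Import Order.TTheory GRing.Theory Num.Theory.

(** * Maximum cuts *)

(** The obstacle is that the colours of [A] are not independent, since mates in [A] get distinct
    colours. A third moment is compared with its value for uniform independent colours by averaging
    one vertex at a time. This does not decrease the moment provided that giving the vertex the
    colour of its mate does not decrease the factor. That always holds for the factor of an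
    unmatched vertex of [B]; for an edge of [B] it holds when the mate is adjacent to the same end,
    and it can fail when the mate is adjacent to the other end. Here the maximality of the cut
    matters beyond both sides inducing matchings: if both further neighbours of an end of such an
    edge had mates, but not each other, then flipping three vertices would improve the cut. So each
    end has a neighbour that can be averaged, and the two colours left over are bounded pointwise,
    whatever their joint law. The exponents 3 and 5 of [theta], and 1 for an edge of [A], are
    numbers of edges. Every edge of [G] is charged once, so the total exponent is [3 * #|G| / 2]. *)

Section Cut.
Variable G : sgraph.
Implicit Types (A : {set G}) (u v w : G).

Definition mono_edge A u v := edge u v && ((u \in A) == (v \in A)).

Lemma mono_edge_sym A u v : mono_edge A u v = mono_edge A v u.
Proof. by rewrite /mono_edge edge_sym eq_sym. Qed.

Lemma mono_edge_irrefl A u : mono_edge A u u = false.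
Proof. by rewrite /mono_edge edge_irrefl. Qed.

Lemma mono_edge_setC A u v : mono_edge (~: A) u v = mono_edge A u v.
Proof. by rewrite /mono_edge !inE; case: (u \in A); case: (v \in A). Qed.

Definition mono_degree A u := \sum_v mono_edge A u v.

Lemma mono_degree_setC A u : mono_degree (~: A) u = mono_degree A u.
Proof. by apply: eq_bigr => v _; rewrite mono_edge_setC. Qed.

Lemma degreeE u : degree u = \sum_v edge u v.
Proof. by rewrite /degree -sum1dep_card big_mkcond; apply: eq_bigr => v _; case: edge. Qed.

Lemma mono_degreeE A u : mono_degree A u = #|[set v | mono_edge A u v]|.
Proof.
by rewrite /mono_degree -sum1dep_card [RHS]big_mkcond; apply: eq_bigr => v _; case: mono_edge.
Qed.

Definition flip A v : {set G} := [set w | (w \in A) (+) (w == v)].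

Lemma mono_degree_flip A u v : u != v ->
  mono_degree (flip A v) u + 2 * mono_edge A u v = mono_degree A u + edge u v.
Proof.
move=> uv; rewrite /mono_degree (bigD1 v)//= [X in _ = X + _](bigD1 v)//=.
rewrite (eq_bigr (fun w => mono_edge A u w : nat)) => [|w wv]; last first.
  by rewrite /mono_edge !inE (negPf uv) (negPf wv) !addbF.
rewrite /mono_edge !inE eqxx (negPf uv) addbF.
by case: (u \in A); case: (v \in A); case: edge => //=; lia.
Qed.

Lemma mono_degree_flip_self A v :
  mono_degree (flip A v) v + mono_degree A v = degree v.
Proof.
rewrite degreeE /mono_degree -big_split/=; apply: eq_bigr => w _.
rewrite /mono_edge !inE eqxx; have [->|wv] := eqVneq w v; first by rewrite edge_irrefl.
by case: (w \in A); case: (v \in A); case: edge.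
Qed.

(** Every edge inside a side is counted twice, once from each end; this explains the coefficients 4
    and 2 of [mono_count_flip]. *)
Definition mono_count A := \sum_u mono_degree A u.

Lemma mono_count_flip A v :
  mono_count (flip A v) + 4 * mono_degree A v = mono_count A + 2 * degree v.
Proof.
rewrite /mono_count (bigD1 v)//= [X in _ = X + _](bigD1 v)//=.
have E : \sum_(u | u != v) mono_degree (flip A v) u + 2 * mono_degree A v =
    \sum_(u | u != v) mono_degree A u + degree v.
  have dE (f : G -> nat) : f v = 0 -> \sum_u f u = \sum_(u | u != v) f u.
    by move=> f0; rewrite (bigD1 v)//= f0.
  rewrite degreeE /mono_degree !(dE (fun u => _ (_ v u))) ?mono_edge_irrefl ?edge_irrefl//.
  rewrite big_distrr/= -!big_split/=; apply: eq_bigr => u uv.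
  by rewrite mono_edge_sym edge_sym; apply: mono_degree_flip.
by have := mono_degree_flip_self A v; lia.
Qed.

(* The second clause is what optimality of a cut says about flipping [j], [i] and
   [i'] simultaneously. *)
Definition good_cut A := (forall v, mono_degree A v <= 1) /\
  (forall j i i', i != i' -> edge j i -> edge j i' -> ~~ mono_edge A j i -> ~~ mono_edge A j i' ->
     mono_degree A j = 1 -> mono_degree A i = 1 -> mono_degree A i' = 1 -> edge i i').

Lemma good_cut_setC A : good_cut A -> good_cut (~: A).
Proof.
case=> h1 h2; split=> [v|j i i']; first by rewrite mono_degree_setC.
by rewrite !mono_edge_setC !mono_degree_setC; apply: h2.
Qed.

Lemma exists_good_cut : regular 3 G -> exists A, good_cut A.
Proof.
move=> G3; case: (arg_minnP (P := xpredT) (i0 := set0 : {set G}) mono_count erefl).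
move=> A _ Amin; exists A; split=> [v|j i i' ii' ji ji' nji nji' mj mi mi'].
  by have := mono_count_flip A v; have := Amin (flip A v) isT; rewrite G3; lia.
apply: contraT => nii'.
have ij : i != j by apply: contraTneq ji => ->; rewrite edge_irrefl.
have i'j : i' != j by apply: contraTneq ji' => ->; rewrite edge_irrefl.
(* Flipping [j] costs 2 and moves its edges to [i] and [i'] inside a side. If [i] and [i'] are not
   adjacent, each then has two edges inside its side, and flipping it gains 2. The net gain
   contradicts minimality. *)
have := mono_count_flip A j; have := mono_count_flip (flip A j) i.
have := mono_count_flip (flip (flip A j) i) i'.
have := mono_degree_flip A ij; have := mono_degree_flip A i'j.
have := @mono_degree_flip (flip A j) i' i; rewrite eq_sym => /(_ ii').
have -> : mono_edge (flip A j) i' i = false by rewrite /mono_edge edge_sym (negPf nii').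
rewrite [edge i' i]edge_sym (negPf nii') !(mono_edge_sym A _ j) (negPf nji) (negPf nji').
rewrite [edge i j]edge_sym ji [edge i' j]edge_sym ji' !G3 mj mi mi'.
by have := Amin (flip (flip (flip A j) i) i') isT; lia.
Qed.

End Cut.

(** * The matching inside the two sides of a cut *)

Section Mate.
Variables (G : sgraph) (A : {set G}).
Hypothesis mono_le1 : forall v, mono_degree A v <= 1.

(** An unmatched vertex is its own mate: [mate] becomes an involution of all vertices, and
    [mate v == v] is the test for being unmatched. *)
Definition mate v := if [pick w | mono_edge A v w] is Some w then w else v.

Lemma mate_mono_edge v w : mono_edge A v w -> mate v = w.
Proof.
move=> vw; rewrite /mate; case: pickP => [w' vw'|/(_ w)]; last by rewrite vw.
by have := mono_le1 v; rewrite mono_degreeE => /card_le1_eqP h; apply: h; rewrite inE.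
Qed.

Variant mate_spec v : G -> bool -> nat -> Type :=
| Mated w of mono_edge A v w : mate_spec v w false 1
| Unmated of (forall w, ~~ mono_edge A v w) : mate_spec v v true 0.

Lemma mateP v : mate_spec v (mate v) (mate v == v) (mono_degree A v).
Proof.
rewrite mono_degreeE /mate; case: pickP => [w vw|h].
  have -> : (w == v) = false by apply: contraTF vw => /eqP ->; rewrite mono_edge_irrefl.
  rewrite (_ : #|_| = 1); first by constructor.
  by apply/eqP; rewrite eqn_leq -mono_degreeE mono_le1 mono_degreeE; apply/card_gt0P; exists w; rewrite inE.
rewrite eqxx (_ : #|_| = 0); first by constructor=> w; rewrite h.
by apply: eq_card0 => w; rewrite inE h.
Qed.

Lemma mateK : involutive mate.
Proof.
move=> v; case: (mateP v) => [w vw|h]; first by apply: mate_mono_edge; rewrite mono_edge_sym.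
by case: (mateP v) => // w; rewrite (negPf (h w)).
Qed.

Lemma mate_side v : (mate v \in A) = (v \in A).
Proof. by case: mateP => // w /andP[_ /eqP ->]. Qed.

Lemma edge_mate v : mate v != v -> edge v (mate v).
Proof. by case: mateP => // w /andP[]. Qed.

Lemma edge_cross v w : edge v w -> w != mate v -> (w \in A) = (v \notin A).
Proof.
move=> vw; apply: contraNeq; rewrite eq_sym => /eqP h; apply/eqP/esym/mate_mono_edge.
by rewrite /mono_edge vw; move: h; case: (v \in A); case: (w \in A).
Qed.

Lemma card_cross v : degree v = 3 ->
  #|[set w | edge v w && (w != mate v)]| = if mate v == v then 3 else 2.
Proof.
move=> d3; have := d3; rewrite /degree (cardsD1 (mate v)) inE.
have -> : [set w | edge v w] :\ mate v = [set w | edge v w && (w != mate v)].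
  by apply/setP => w; rewrite !inE andbC.
by case: eqVneq => [->|/edge_mate ->]; rewrite ?edge_irrefl/= => -[].
Qed.

End Mate.

Local Open Scope ring_scope.

(** * Hoelder inequalities *)

Section CubeRoot.
Variable R : realType.
Implicit Types x y : R.

Definition cbrt x : R := x `^ 3^-1.

Lemma cbrt_ge0 x : 0 <= cbrt x. Proof. exact: powR_ge0. Qed.

Lemma cbrtK x : 0 <= x -> cbrt x ^+ 3 = x.
Proof. by move=> x0; rewrite -powR_mulrn ?cbrt_ge0// -powRrM mulVf ?powRr1 ?pnatr_eq0. Qed.

Lemma cbrtX x : 0 <= x -> cbrt (x ^+ 3) = x.
Proof. by move=> x0; rewrite /cbrt -powR_mulrn// -powRrM mulfV ?powRr1 ?pnatr_eq0. Qed.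

Lemma cbrtM x y : 0 <= x -> 0 <= y -> cbrt (x * y) = cbrt x * cbrt y.
Proof. exact: powRM. Qed.

Lemma cbrt1 : cbrt 1 = 1. Proof. by rewrite -[1](expr1n _ 3) cbrtX ?expr1n. Qed.

Lemma cbrt_gt0 x : 0 < x -> 0 < cbrt x.
Proof. exact: powR_gt0. Qed.

Lemma cbrt_div3 x y z d : 0 <= x -> 0 <= y -> 0 <= z -> 0 <= d ->
  cbrt (x / d) * cbrt (y / d) * cbrt (z / d) = cbrt x * cbrt y * cbrt z / d.
Proof.
move=> x0 y0 z0 d0; rewrite !cbrtM ?invr_ge0// -[in RHS](@cbrtK d^-1) ?invr_ge0//.
by ring.
Qed.

End CubeRoot.

Section Hoelder.
Variables (R : realType) (I : finType) (P : pred I).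
Implicit Types a b c : I -> R.

Lemma amgm3 (x y z : R) : 0 <= x -> 0 <= y -> 0 <= z ->
  x * y * z <= (x ^+ 3 + y ^+ 3 + z ^+ 3) / 3.
Proof.
move=> x0 y0 z0; rewrite ler_pdivlMr// -subr_ge0.
have -> : x ^+ 3 + y ^+ 3 + z ^+ 3 - x * y * z * 3 =
  (x + y + z) * ((x - y) ^+ 2 + (y - z) ^+ 2 + (x - z) ^+ 2) / 2 by field.
by rewrite divr_ge0// mulr_ge0 ?addr_ge0 ?sqr_ge0.
Qed.

Lemma amgm3_lt (x y z : R) : 0 <= x -> 0 <= y -> 0 <= z -> x != y ->
  x * y * z < (x ^+ 3 + y ^+ 3 + z ^+ 3) / 3.
Proof.
move=> x0 y0 z0 xy; rewrite ltr_pdivlMr// -subr_gt0.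
have -> : x ^+ 3 + y ^+ 3 + z ^+ 3 - x * y * z * 3 =
  (x + y + z) * ((x - y) ^+ 2 + ((y - z) ^+ 2 + (x - z) ^+ 2)) / 2 by field.
rewrite divr_gt0// mulr_gt0//; last first.
  by rewrite ltr_wpDr ?addr_ge0 ?sqr_ge0// exprn_even_gt0//= subr_eq0.
rewrite ltr_wpDr// lt_neqAle addr_ge0// andbT eq_sym paddr_eq0//.
by apply/negP => /andP[/eqP x_0 /eqP y_0]; rewrite x_0 y_0 eqxx in xy.
Qed.

Lemma sum_cube_eq0 a : (forall i, 0 <= a i) -> \sum_(i | P i) a i ^+ 3 = 0 ->
  forall i, P i -> a i = 0.
Proof.
move=> a0 /eqP; rewrite psumr_eq0; last by move=> i _; rewrite exprn_ge0.
by move=> /allP h i Pi; have /implyP/(_ Pi) := h i (mem_index_enum _); rewrite expf_eq0/= => /eqP.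
Qed.

Lemma hoelder3 a b c : (forall i, 0 <= a i) -> (forall i, 0 <= b i) ->
  (forall i, 0 <= c i) ->
  \sum_(i | P i) a i * b i * c i <= cbrt (\sum_(i | P i) a i ^+ 3) *
    cbrt (\sum_(i | P i) b i ^+ 3) * cbrt (\sum_(i | P i) c i ^+ 3).
Proof.
move=> a0 b0 c0.
have S0 f : (forall i, 0 <= f i) -> 0 <= \sum_(i | P i) f i ^+ 3 :> R.
  by move=> f0; apply: sumr_ge0 => i _; rewrite exprn_ge0.
have [A0|A0] := eqVneq (\sum_(i | P i) a i ^+ 3) 0.
  rewrite big1 ?mulr_ge0 ?cbrt_ge0// => i Pi.
  by rewrite (sum_cube_eq0 a0 A0 Pi) !mul0r.
have [B0|B0] := eqVneq (\sum_(i | P i) b i ^+ 3) 0.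
  rewrite big1 ?mulr_ge0 ?cbrt_ge0// => i Pi.
  by rewrite (sum_cube_eq0 b0 B0 Pi) mulr0 mul0r.
have [C0|C0] := eqVneq (\sum_(i | P i) c i ^+ 3) 0.
  rewrite big1 ?mulr_ge0 ?cbrt_ge0// => i Pi.
  by rewrite (sum_cube_eq0 c0 C0 Pi) mulr0.
move: (cbrtK (S0 a a0)) (cbrtK (S0 b b0)) (cbrtK (S0 c c0)).
have pos f : (forall i, 0 <= f i) -> \sum_(i | P i) f i ^+ 3 != 0 ->
  0 < cbrt (\sum_(i | P i) f i ^+ 3) :> R.
  by move=> f0 fn; rewrite cbrt_gt0// lt_neqAle eq_sym fn S0.
move: (pos a a0 A0) (pos b b0 B0) (pos c c0 C0).
set al := cbrt _; set be := cbrt _; set ga := cbrt _ => al0 be0 ga0 alE beE gaE.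
rewrite -[leRHS]mul1r -ler_pdivrMr ?mulr_gt0//.
rewrite mulr_suml.
apply: (@le_trans _ _ (\sum_(i | P i) ((a i / al) ^+ 3 + (b i / be) ^+ 3 + (c i / ga) ^+ 3) / 3)).
  apply: ler_sum => i _.
  have -> : a i * b i * c i / (al * be * ga) = (a i / al) * (b i / be) * (c i / ga).
    by field; rewrite ?gt_eqF.
  by apply: amgm3; rewrite divr_ge0 ?a0 ?b0 ?c0 ?ltW.
under eq_bigr do rewrite !exprMn !exprVn alE beE gaE.
rewrite -mulr_suml !big_split/= -!mulr_suml !mulfV//.
by rewrite ler_pdivrMr//; lra.
Qed.

(** The last hypothesis says that the normalised [a] and [b] differ at [k]; the term of [k] in the
    AM-GM step is then strict. *)
Lemma hoelder3_lt a b c (k : I) : (forall i, 0 <= a i) -> (forall i, 0 <= b i) ->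
  (forall i, 0 <= c i) -> P k ->
  0 < \sum_(i | P i) a i ^+ 3 -> 0 < \sum_(i | P i) b i ^+ 3 ->
  0 < \sum_(i | P i) c i ^+ 3 ->
  a k ^+ 3 * (\sum_(i | P i) b i ^+ 3) != b k ^+ 3 * (\sum_(i | P i) a i ^+ 3) ->
  \sum_(i | P i) a i * b i * c i < cbrt (\sum_(i | P i) a i ^+ 3) *
    cbrt (\sum_(i | P i) b i ^+ 3) * cbrt (\sum_(i | P i) c i ^+ 3).
Proof.
move=> a0 b0 c0 Pk A0 B0 C0.
move: (cbrtK (ltW A0)) (cbrtK (ltW B0)) (cbrtK (ltW C0)).
move: (cbrt_gt0 A0) (cbrt_gt0 B0) (cbrt_gt0 C0).
set al := cbrt _; set be := cbrt _; set ga := cbrt _ => al0 be0 ga0 alE beE gaE.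
move=> nprop.
rewrite -[ltRHS]mul1r -ltr_pdivrMr ?mulr_gt0//.
rewrite mulr_suml.
apply: (@lt_le_trans _ _ (\sum_(i | P i) ((a i / al) ^+ 3 + (b i / be) ^+ 3 + (c i / ga) ^+ 3) / 3)).
  have E i : a i * b i * c i / (al * be * ga) = (a i / al) * (b i / be) * (c i / ga).
    by field; rewrite ?gt_eqF.
  rewrite (bigD1 k)//= [ltRHS](bigD1 k)//= ltr_leD//.
    rewrite E; apply: amgm3_lt; rewrite ?divr_ge0 ?a0 ?b0 ?c0 ?ltW//.
    apply: contra nprop => /eqP/(congr1 (fun x => x ^+ 3)).
    rewrite !exprMn !exprVn alE beE => /eqP.
    by rewrite eqr_div ?lt0r_neq0.
  apply: ler_sum => i _; rewrite E.
  by apply: amgm3; rewrite divr_ge0 ?a0 ?b0 ?c0 ?ltW.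
under eq_bigr do rewrite !exprMn !exprVn alE beE gaE.
rewrite -mulr_suml !big_split/= -!mulr_suml !mulfV ?gt_eqF//.
by rewrite ler_pdivrMr//; lra.
Qed.

End Hoelder.

(** * Power sums and the norm of the kernel [i != j] *)

Section PowerSums.
Variables (R : realFieldType) (I : finType).
Implicit Types (u : I -> R) (f : I -> I -> R).

(** Lagrange's identity: twice the difference of the two sides is a double sum of squares. *)
Lemma cauchy_schwarz (u v : I -> R) :
  (\sum_i u i * v i) ^+ 2 <= (\sum_i u i ^+ 2) * (\sum_i v i ^+ 2).
Proof.
have E : 0 <= \sum_i \sum_j (u i * v j - u j * v i) ^+ 2.
  by apply: sumr_ge0 => i _; apply: sumr_ge0 => j _; rewrite sqr_ge0.
have S (a b : I -> R) : (\sum_i a i) * (\sum_i b i) = \sum_i \sum_j a i * b j.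
  by rewrite big_distrlr.
rewrite -subr_ge0 -(@pmulr_rge0 _ 2)//.
suff -> : 2 * ((\sum_i u i ^+ 2) * (\sum_i v i ^+ 2) - (\sum_i u i * v i) ^+ 2) =
  \sum_i \sum_j (u i * v j - u j * v i) ^+ 2 by [].
rewrite mulrBr expr2 !S -[2 in X in X - _]/(1 + 1) mulrDl mul1r.
rewrite [X in _ + X - _]exchange_big/= -!big_split/= mulr_sumr -sumrB.
apply: eq_bigr => i _; rewrite -!big_split/= mulr_sumr -sumrB.
by apply: eq_bigr => j _; ring.
Qed.

Let p u k := \sum_i u i ^+ k.

Let dsum f := \sum_i \sum_j f i j.

Let dsumD f g : dsum (fun i j => f i j + g i j) = dsum f + dsum g.
Proof. by rewrite /dsum -big_split/=; apply: eq_bigr => i _; rewrite big_split. Qed.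

Let dsumX a u k l : dsum (fun i j => a * (u i ^+ k * u j ^+ l)) = a * (p u k * p u l).
Proof.
rewrite /p big_distrlr/= mulr_sumr; apply: eq_bigr => i _.
by rewrite mulr_sumr.
Qed.

Let dsum_ge0 f : (forall i j, 0 <= f i j) -> 0 <= dsum f.
Proof. by move=> f0; apply: sumr_ge0 => i _; apply: sumr_ge0. Qed.

Let eq_dsum f g : (forall i j, f i j = g i j) -> dsum f = dsum g.
Proof. by move=> fg; apply: eq_bigr => i _; apply: eq_bigr => j _; apply: fg. Qed.

Hypothesis I_ge3 : (3 <= #|I|)%N.

(* With [p k = \sum_i u i ^+ k] the claim reads
   [(q-1)^3 p3^2 >= q ((q-3) p2^3 + 3 p2 p4 - p6)]; the difference of the two
   sides is the sum of [q p6 + 8 p3^2 - 9 p2 p4], which is half the double sum of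
   [(u i - u j)^4 (u i^2 + 4 u i u j + u j^2)], and of
   [(q-3) (q (q p3^2 - p2^3) - 3 (p2 p4 - p3^2))]. *)
Lemma cube_norm_bound u : (forall i, 0 <= u i) ->
  #|I|%:R * (\sum_i (\sum_j u j ^+ 2 - u i ^+ 2) ^+ 3) <=
  (#|I|%:R - 1) ^+ 3 * (\sum_i u i ^+ 3) ^+ 2.
Proof.
move=> u0; set s := \sum_j u j ^+ 2.
set q : R := #|I|%:R; have q3 : 3 <= q by rewrite ler_nat.
have p0E : p u 0 = q by rewrite /p sumr_const.
have p0 k : 0 <= p u k by apply: sumr_ge0 => i _; rewrite exprn_ge0.
have -> : \sum_i (s - u i ^+ 2) ^+ 3 = (q - 3) * s ^+ 3 + 3 * s * p u 4 - p u 6.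
  have E i : (s - u i ^+ 2) ^+ 3 =
      s ^+ 3 + (3 * s) * u i ^+ 4 - u i ^+ 6 - 3 * s ^+ 2 * u i ^+ 2 by ring.
  under eq_bigr do rewrite E.
  rewrite !(sumrB, big_split)/= sumr_const -!mulr_sumr -/s -mulr_natl -/q.
  by rewrite -/(p u 4) -/(p u 6); ring.
rewrite -/(p u 3); have -> : s = p u 2 by [].
have quartic : 0 <= q * p u 6 + 8 * p u 3 ^+ 2 - 9 * (p u 2 * p u 4).
  have : 0 <= dsum (fun i j => (u i - u j) ^+ 4 * (u i ^+ 2 + 4 * (u i * u j) + u j ^+ 2)).
    apply: dsum_ge0 => i j; rewrite mulr_ge0 ?addr_ge0 ?sqr_ge0//; last by rewrite !mulr_ge0.
    by rewrite exprn_even_ge0.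
  rewrite (@eq_dsum _ (fun i j => 1 * (u i ^+ 6 * u j ^+ 0) + (1 * (u i ^+ 0 * u j ^+ 6) +
    (16 * (u i ^+ 3 * u j ^+ 3) + ((- 9) * (u i ^+ 2 * u j ^+ 4) +
     (- 9) * (u i ^+ 4 * u j ^+ 2)))))); last by move=> i j; ring.
  by rewrite !dsumD !dsumX p0E; lra.
have p13 : p u 2 ^+ 2 <= p u 1 * p u 3.
  have : 0 <= dsum (fun i j => u i * u j * (u i - u j) ^+ 2).
    by apply: dsum_ge0 => i j; apply: mulr_ge0; rewrite ?sqr_ge0 ?mulr_ge0.
  rewrite (@eq_dsum _ (fun i j => 1 * (u i ^+ 3 * u j ^+ 1) + (1 * (u i ^+ 1 * u j ^+ 3) +
    (- 2) * (u i ^+ 2 * u j ^+ 2)))); last by move=> i j; ring.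
  by rewrite !dsumD !dsumX expr2; lra.
(* Half of a double sum whose terms are nonnegative because [q >= 3], [p 3] is at least the mean of
   [u i ^ 3] and [u j ^ 3], and [(x^3 + y^3) (x + y) >= 2 x^2 y^2]. *)
have D : 3 * (p u 2 * p u 4 - p u 3 ^+ 2) <= q * p u 3 * (q * p u 3 - p u 1 * p u 2).
  have : 0 <= dsum (fun i j => (u i - u j) ^+ 2 *
      (q * p u 3 * (u i + u j) - 3 * (u i ^+ 2 * u j ^+ 2))).
    apply: dsum_ge0 => i j; rewrite mulr_ge0 ?sqr_ge0// subr_ge0.
    have p3 k : u k ^+ 3 <= p u 3.
      by rewrite /p (bigD1 k)//= lerDl sumr_ge0// => *; rewrite exprn_ge0.
    apply: (@le_trans _ _ (3 * p u 3 * (u i + u j))); last first.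
      by rewrite ler_wpM2r ?addr_ge0// ler_wpM2r.
    apply: (@le_trans _ _ (3 * ((u i ^+ 3 + u j ^+ 3) / 2) * (u i + u j))).
      rewrite -mulrA ler_wpM2l// [leRHS]mulrAC ler_pdivlMr// -subr_ge0.
      have -> : (u i ^+ 3 + u j ^+ 3) * (u i + u j) - u i ^+ 2 * u j ^+ 2 * 2 =
        (u i ^+ 2 - u j ^+ 2) ^+ 2 + u i * u j * (u i ^+ 2 + u j ^+ 2) by ring.
      by rewrite addr_ge0 ?sqr_ge0// mulr_ge0 ?addr_ge0 ?sqr_ge0 ?mulr_ge0.
    rewrite ler_wpM2r ?addr_ge0// ler_wpM2l//.
    by have := p3 i; have := p3 j; lra.
  rewrite (@eq_dsum _ (fun i j => (q * p u 3) * (u i ^+ 3 * u j ^+ 0) +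
    ((q * p u 3) * (u i ^+ 0 * u j ^+ 3) + ((- (q * p u 3)) * (u i ^+ 2 * u j ^+ 1) +
    ((- (q * p u 3)) * (u i ^+ 1 * u j ^+ 2) + ((- 3) * (u i ^+ 4 * u j ^+ 2) +
    ((- 3) * (u i ^+ 2 * u j ^+ 4) + 6 * (u i ^+ 3 * u j ^+ 3)))))))); last first.
    by move=> i j; ring.
  by rewrite !dsumD !dsumX p0E; lra.
have D' : 3 * (p u 2 * p u 4 - p u 3 ^+ 2) <= q * (q * p u 3 ^+ 2 - p u 2 ^+ 3).
  have q0 : 0 <= q by rewrite ler0n.
  apply: (le_trans D); rewrite -mulrA ler_wpM2l// -subr_ge0.
  have -> : q * p u 3 ^+ 2 - p u 2 ^+ 3 - p u 3 * (q * p u 3 - p u 1 * p u 2) =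
    p u 2 * (p u 1 * p u 3 - p u 2 ^+ 2) by ring.
  by rewrite mulr_ge0// subr_ge0.
rewrite -subr_ge0.
have -> : (q - 1) ^+ 3 * p u 3 ^+ 2 -
  q * ((q - 3) * p u 2 ^+ 3 + 3 * p u 2 * p u 4 - p u 6) =
  (q * p u 6 + 8 * p u 3 ^+ 2 - 9 * (p u 2 * p u 4)) + (q - 3) *
  (q * (q * p u 3 ^+ 2 - p u 2 ^+ 3) - 3 * (p u 2 * p u 4 - p u 3 ^+ 2)) by ring.
by rewrite addr_ge0// mulr_ge0// subr_ge0.
Qed.

End PowerSums.

Section Bilinear.
Variables (R : realType) (I : finType).
Hypothesis I_ge3 : (3 <= #|I|)%N.
Implicit Types a b c d : I -> R.

Lemma sum_neq (F : I -> I -> R) :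
  \sum_i \sum_(j | i != j) F i j = \sum_i \sum_j F i j - \sum_i F i i.
Proof.
rewrite -sumrB; apply: eq_bigr => i _; rewrite [X in _ = X - _](bigD1 i)//=.
by rewrite addrAC subrr add0r; apply: eq_bigl => j; rewrite eq_sym.
Qed.

Lemma card_neq (i : I) : #|[pred j | i != j]| = #|I|.-1.
Proof.
by rewrite (cardD1 i predT) inE/=; apply: eq_card => j; rewrite !inE andbT eq_sym.
Qed.

(** With [u^2 = a b] and [t j] the sum of [u i ^ 2] over [i != j], Hoelder's inequality for [c],
    [d], [t] leaves the cube norm of [t]. By [cube_norm_bound] it is controlled by the sum of [u^3],
    and Cauchy-Schwarz for [a^(3/2)] and [b^(3/2)] separates [a] from [b]. Constants give equality,
    so the form with means, [mean_hoelder_neq], has constant 1. *)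
Lemma hoelder_neq a b c d : (forall i, 0 <= a i) -> (forall i, 0 <= b i) ->
  (forall i, 0 <= c i) -> (forall i, 0 <= d i) ->
  #|I|%:R * (\sum_i \sum_(j | i != j) a i * b i * (c j * d j)) ^+ 3 <=
  (#|I|%:R - 1) ^+ 3 * ((\sum_i a i ^+ 3) * (\sum_i b i ^+ 3) *
    ((\sum_i c i ^+ 3) * (\sum_i d i ^+ 3))).
Proof.
move=> a0 b0 c0 d0.
pose u i := Num.sqrt (a i * b i).
have u2 i : u i ^+ 2 = a i * b i by rewrite sqr_sqrtr ?mulr_ge0.
have u0 i : 0 <= u i by rewrite sqrtr_ge0.
set t := fun j => \sum_i u i ^+ 2 - u j ^+ 2.
have t0 j : 0 <= t j.
  by rewrite /t (bigD1 j)//= addrAC subrr add0r sumr_ge0// => *; rewrite sqr_ge0.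
have -> : \sum_i \sum_(j | i != j) a i * b i * (c j * d j) = \sum_j c j * d j * t j.
  rewrite sum_neq exchange_big/= -sumrB; apply: eq_bigr => j _.
  by rewrite -mulr_suml mulrC /t mulrBr; under eq_bigr do rewrite -u2; rewrite u2; ring.
have S0 (e : I -> R) : (forall i, 0 <= e i) -> 0 <= \sum_i e i ^+ 3.
  by move=> e0; apply: sumr_ge0 => i _; rewrite exprn_ge0.
have H : (\sum_j c j * d j * t j) ^+ 3 <=
    (\sum_i c i ^+ 3) * (\sum_i d i ^+ 3) * (\sum_i t i ^+ 3).
  have := @hoelder3 R I predT c d t c0 d0 t0.
  rewrite -(@ler_pXn2r _ 3)// ?nnegrE ?mulr_ge0 ?cbrt_ge0 ?sumr_ge0//; last first.
    by move=> *; rewrite !mulr_ge0.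
  by rewrite !exprMn !cbrtK ?S0.
apply: (@le_trans _ _ (#|I|%:R * ((\sum_i c i ^+ 3) * (\sum_i d i ^+ 3) * (\sum_i t i ^+ 3)))).
  by rewrite ler_wpM2l.
rewrite mulrCA [leRHS]mulrA [leRHS]mulrC ler_wpM2l ?mulr_ge0 ?S0//.
apply: (le_trans (cube_norm_bound I_ge3 u0)).
rewrite ler_wpM2l ?exprn_ge0// ?subr_ge0 ?ler1n ?(leq_trans _ I_ge3)//.
pose v (e : I -> R) i := Num.sqrt (e i ^+ 3).
have v2 (e : I -> R) i : (forall i, 0 <= e i) -> v e i ^+ 2 = e i ^+ 3.
  by move=> e0; rewrite sqr_sqrtr ?exprn_ge0.
have -> : \sum_i u i ^+ 3 = \sum_i v a i * v b i.
  apply: eq_bigr => i _; rewrite /v -sqrtrM ?exprn_ge0// -exprMn -u2 -exprM mulnC exprM.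
  by rewrite sqrtr_sqr ger0_norm ?exprn_ge0.
apply: (le_trans (cauchy_schwarz _ _)).
by rewrite (eq_bigr _ (fun i _ => v2 a i a0)) (eq_bigr _ (fun i _ => v2 b i b0)).
Qed.

End Bilinear.

(** Normalising makes the constant 1 have norm 1, so that factors which do not see the averaged
    coordinates drop out of Hoelder's inequality. *)
Definition mean (R : realFieldType) (J : finType) (D : {set J}) (f : J -> R) : R :=
  (\sum_(p in D) f p) / #|D|%:R.

Section MeanTheory.
Variables (R : realFieldType) (J : finType) (D : {set J}).
Implicit Types f g h : J -> R.

Lemma mean_ge0 f : (forall p, 0 <= f p) -> 0 <= mean D f.
Proof. by move=> f0; rewrite divr_ge0// sumr_ge0. Qed.

Lemma eq_mean f g : {in D, f =1 g} -> mean D f = mean D g.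
Proof. by move=> fg; congr (_ / _); apply: eq_bigr. Qed.

Lemma le_mean f g : {in D, forall p, f p <= g p} -> mean D f <= mean D g.
Proof. by move=> fg; rewrite ler_wpM2r ?invr_ge0// ler_sum. Qed.

Lemma meanMr f (a : R) : mean D (fun p => f p * a) = mean D f * a.
Proof. by rewrite /mean -mulr_suml mulrAC. Qed.

Lemma meanMl f (a : R) : mean D (fun p => a * f p) = a * mean D f.
Proof. by rewrite /mean -mulr_sumr mulrA. Qed.

Lemma meanD f g : mean D (fun p => f p + g p) = mean D f + mean D g.
Proof. by rewrite /mean big_split/= mulrDl. Qed.

Hypothesis D_gt0 : (0 < #|D|)%N.

Lemma mean_const (a : R) : mean D (fun=> a) = a.
Proof. by rewrite /mean sumr_const -[X in X / _]mulr_natr mulfK// pnatr_eq0 -lt0n. Qed.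

End MeanTheory.

Section MeanHoelder.
Variables (R : realType) (J K : finType) (D : {set J}).
Implicit Types (f g h : J -> R) (F : K -> J -> R).
Hypothesis D_gt0 : (0 < #|D|)%N.

Let cardD_cbrt : (#|D|%:R : R) = cbrt #|D|%:R * cbrt #|D|%:R * cbrt #|D|%:R.
Proof. by rewrite -[LHS]cbrtK// !exprS expr0 mulr1 mulrA. Qed.

Let mean_sum_cbrt f : (forall p, 0 <= f p) ->
  \sum_(p in D) cbrt (f p) ^+ 3 = mean D f * #|D|%:R.
Proof.
move=> f0; rewrite /mean divfK ?pnatr_eq0 -?lt0n//.
by apply: eq_bigr => p _; rewrite cbrtK.
Qed.

Lemma mean_hoelder3 f g h : (forall p, 0 <= f p) -> (forall p, 0 <= g p) ->
  (forall p, 0 <= h p) ->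
  mean D (fun p => cbrt (f p) * cbrt (g p) * cbrt (h p)) <=
  cbrt (mean D f) * cbrt (mean D g) * cbrt (mean D h).
Proof.
move=> f0 g0 h0; rewrite {1}/mean ler_pdivrMr ?ltr0n//.
apply: le_trans (hoelder3 _ _ _ _) _ => [p|p|p|]; try exact: cbrt_ge0.
have cM (x : R) : 0 <= x -> cbrt (x * #|D|%:R) = cbrt x * cbrt #|D|%:R.
  by move=> x0; rewrite cbrtM.
rewrite !mean_sum_cbrt// !cM ?mean_ge0// [X in _ <= _ * X]cardD_cbrt.
by rewrite -subr_ge0 le_eqVlt; apply/orP; left; apply/eqP; ring.
Qed.

(** A product of fewer than three factors is completed by the constant 1. *)
Lemma mean_hoelder_seq (ks : seq K) F : (size ks <= 3)%N ->
  (forall k p, 0 <= F k p) ->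
  mean D (fun p => \prod_(k <- ks) cbrt (F k p)) <=
  \prod_(k <- ks) cbrt (mean D (F k)).
Proof.
move=> ks3 F0.
have one : cbrt (mean D (fun=> 1)) = 1 :> R by rewrite mean_const// cbrt1.
have e1 : forall p : J, 0 <= 1 :> R by [].
case: ks ks3 => [|k1 [|k2 [|k3 [|]]]]// _.
- by rewrite big_nil; under eq_mean do rewrite big_nil; rewrite mean_const.
- have := mean_hoelder3 (F0 k1) e1 e1; rewrite !one !mulr1 big_seq1.
  by apply: le_trans; apply: le_mean => p _; rewrite big_seq1 cbrt1 !mulr1.
- have := mean_hoelder3 (F0 k1) (F0 k2) e1; rewrite !one !mulr1 !big_cons big_nil mulr1.
  by apply: le_trans; apply: le_mean => p _; rewrite !big_cons big_nil cbrt1 !mulr1.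
- have := mean_hoelder3 (F0 k1) (F0 k2) (F0 k3); rewrite !big_cons big_nil mulr1 mulrA.
  by apply: le_trans; apply: le_mean => p _; rewrite !big_cons big_nil mulr1 mulrA.
Qed.

Lemma mean_hoelder_set (S N : {set K}) F : (#|N| <= 3)%N ->
  (forall k p, 0 <= F k p) ->
  (forall k, k \in S -> k \notin N -> {in D &, forall p p', F k p = F k p'}) ->
  mean D (fun p => \prod_(k in S) cbrt (F k p)) <= \prod_(k in S) cbrt (mean D (F k)).
Proof.
move=> N3 F0 Fconst.
have split (a : K -> R) : \prod_(k in S) a k =
    (\prod_(k <- enum (S :&: N)) a k) * \prod_(k in S | k \notin N) a k.
  by rewrite big_enum/= (bigID (mem N))/=; congr (_ * _); apply: eq_bigl => k; rewrite inE.
rewrite split.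
under eq_mean => p _ do rewrite split.
rewrite (@eq_mean _ _ _ _ (fun p => (\prod_(k <- enum (S :&: N)) cbrt (F k p)) *
  \prod_(k in S | k \notin N) cbrt (mean D (F k)))); last first.
  move=> p pD; congr (_ * _); apply: eq_bigr => k /andP[kS kN]; congr cbrt.
  rewrite (@eq_mean _ _ _ _ (fun=> F k p)) ?mean_const// => p' p'D.
  exact: Fconst.
rewrite meanMr ler_wpM2r//; first by rewrite prodr_ge0// => *; rewrite cbrt_ge0.
apply: mean_hoelder_seq => //; rewrite -cardE.
by apply: leq_trans N3; rewrite subset_leq_card// subsetIr.
Qed.

End MeanHoelder.

Section MatedBlock.
Variables (R : realType) (I K : finType).
Hypothesis I_ge3 : (3 <= #|I|)%N.

Definition offdiag : {set I * I} := [set p | p.1 != p.2].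

Lemma card_offdiag : #|offdiag| = (#|I| * #|I|.-1)%N.
Proof.
rewrite -sum1_card (eq_bigl (fun p : I * I => p.1 != p.2)); last first.
  by move=> p; rewrite inE.
rewrite -(pair_big_dep predT (fun i j => i != j) (fun _ _ => 1%N))/=.
by under eq_bigr => i _ do rewrite sum1_card card_neq; rewrite sum_nat_const.
Qed.

Lemma sum_offdiag (f : I * I -> R) :
  \sum_(p in offdiag) f p = \sum_i \sum_(j | i != j) f (i, j).
Proof.
rewrite (pair_big_dep predT (fun i j => i != j) (fun i j => f (i, j)))/=.
by apply: eq_big => [p|[]//]; rewrite inE.
Qed.

Lemma mean_offdiag_fst (f : I -> R) :
  mean offdiag (fun p => f p.1) = mean [set: I] f.
Proof.
rewrite /mean sum_offdiag card_offdiag cardsT.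
have neqE (x : R) i : \sum_(j : I | i != j) x = x * #|I|.-1%:R.
  by rewrite mulr_natr -(card_neq i) -sumr_const.
under eq_bigr => i _ do rewrite /= neqE.
rewrite -mulr_suml natrM [in RHS](eq_bigl predT) => [|i]; last by rewrite inE.
rewrite -mulf_div divff ?mulr1// pnatr_eq0.
by case: #|I| I_ge3 => [|[]].
Qed.

Lemma mean_offdiag_snd (f : I -> R) :
  mean offdiag (fun p => f p.2) = mean [set: I] f.
Proof.
rewrite -mean_offdiag_fst /mean !sum_offdiag; congr (_ / _).
rewrite (exchange_big_dep predT)//=; apply: eq_bigr => i _.
by apply: eq_bigl => j; rewrite eq_sym.
Qed.

Lemma mean_hoelder_neq (a b c d : I -> R) :
  (forall i, 0 <= a i) -> (forall i, 0 <= b i) ->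
  (forall i, 0 <= c i) -> (forall i, 0 <= d i) ->
  mean offdiag (fun p => cbrt (a p.1) * cbrt (b p.1) * (cbrt (c p.2) * cbrt (d p.2))) <=
  cbrt (mean [set: I] a) * cbrt (mean [set: I] b) *
  (cbrt (mean [set: I] c) * cbrt (mean [set: I] d)).
Proof.
move=> a0 b0 c0 d0.
have q0 : 0 < #|I|%:R :> R by rewrite ltr0n (leq_trans _ I_ge3).
have q1 : 0 < #|I|%:R - 1 :> R by rewrite subr_gt0 ltr1n (leq_trans _ I_ge3).
have := @hoelder_neq R I I_ge3 (@cbrt R \o a) (@cbrt R \o b) (@cbrt R \o c) (@cbrt R \o d).
move/(_ (fun=> cbrt_ge0 _) (fun=> cbrt_ge0 _) (fun=> cbrt_ge0 _) (fun=> cbrt_ge0 _)).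
have S (f : I -> R) : (forall i, 0 <= f i) ->
    \sum_i (@cbrt R \o f) i ^+ 3 = mean [set: I] f * #|I|%:R.
  move=> f0; rewrite /mean cardsT divfK ?gt_eqF//.
  by apply: eq_big => [i|i _]; rewrite ?inE//= cbrtK.
rewrite !S// => H.
rewrite -(@ler_pXn2r _ 3)//; last 2 first.
- by rewrite nnegrE mean_ge0// => p; rewrite !mulr_ge0 ?cbrt_ge0.
- by rewrite nnegrE !mulr_ge0 ?cbrt_ge0.
rewrite !exprMn !cbrtK ?mean_ge0// /mean sum_offdiag card_offdiag.
have -> : (#|I| * #|I|.-1)%:R = #|I|%:R * (#|I|%:R - 1) :> R.
  by rewrite natrM; case: #|I| I_ge3 => // n _; rewrite /= -addn1 natrD addrK.
rewrite exprVn ler_pdivrMr ?exprn_gt0 ?mulr_gt0//.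
rewrite -(ler_pM2l q0); apply: le_trans H _.
rewrite /mean cardsT -subr_ge0 le_eqVlt; apply/orP; left; apply/eqP.
by field; rewrite gt_eqF.
Qed.

(* When no factor involves both coordinates, each coordinate meets at most two
   factors and [mean_hoelder_neq] applies; otherwise at most three factors are not
   constant and the ordinary Hoelder inequality is enough. *)
Lemma mean_hoelder_block (S N1 N2 : {set K}) (F : K -> I * I -> R) :
  (#|N1| <= 2)%N -> (#|N2| <= 2)%N -> (forall k p, 0 <= F k p) ->
  (forall k, k \in S -> k \notin N1 -> forall i i' j, F k (i, j) = F k (i', j)) ->
  (forall k, k \in S -> k \notin N2 -> forall i j j', F k (i, j) = F k (i, j')) ->
  mean offdiag (fun p => \prod_(k in S) cbrt (F k p)) <=
  \prod_(k in S) cbrt (mean offdiag (F k)).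
Proof.
move=> N12 N22 F0 F1 F2.
have D0 : (0 < #|offdiag|)%N.
  by rewrite card_offdiag; case: #|I| I_ge3 => [|[|n]].
(* If [k0] lies in both sets, of at most two elements each, their union has at most three
   elements. *)
have [k0 k0P|N0] := pickP (mem (S :&: N1 :&: N2)).
  apply: (@mean_hoelder_set _ _ _ _ D0 S (N1 :|: N2)) => //.
    move: k0P; rewrite !inE => /andP[/andP[_ k1] k2].
    have : (#|N1 :&: N2| > 0)%N by apply/card_gt0P; exists k0; rewrite inE k1.
    by have := cardsUI N1 N2; lia.
  move=> k kS; rewrite inE negb_or => /andP[k1 k2] [i j] [i' j'] _ _.
  by rewrite (F1 _ kS k1 i i') (F2 _ kS k2 i' j j').
have i0 : I by case: (pickP I) => [i _//|/eq_card0 E]; move: I_ge3; rewrite E.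
pose S1 := S :&: N1; pose S2 := S :&: N2; pose S0 := S :\: (N1 :|: N2).
have splitS (a : K -> R) : \prod_(k in S) a k =
    (\prod_(k <- enum S1) a k) * (\prod_(k <- enum S2) a k) * \prod_(k in S0) a k.
  rewrite /S1 /S2 /S0 !big_enum/= (bigID (mem N1))/= -mulrA; congr (_ * _).
    by apply: eq_bigl => k; rewrite inE.
  rewrite (bigID (mem N2))/=; congr (_ * _); apply: eq_bigl => k.
    rewrite inE -andbA; have := N0 k; rewrite /= !inE.
    by case: (k \in S) (k \in N1) (k \in N2) => [] [] [].
  by rewrite !inE negb_or -andbA andbC.
pose G1 k i := F k (i, i0); pose G2 k j := F k (i0, j).
have S1E k : k \in S1 -> forall p, F k p = G1 k p.1.
  rewrite inE => /andP[kS k1] [i j]; apply: F2 => //.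
  by apply/negP => k2; have := N0 k; rewrite /= !inE kS k1 k2.
have S2E k : k \in S2 -> forall p, F k p = G2 k p.2.
  rewrite inE => /andP[kS k2] [i j]; apply: F1 => //.
  by apply/negP => k1; have := N0 k; rewrite /= !inE kS k1 k2.
have S0E k : k \in S0 -> forall p, F k p = F k (i0, i0).
  rewrite !inE negb_or => /andP[/andP[k1 k2] kS] [i j].
  by rewrite (F1 _ kS k1 i i0) (F2 _ kS k2 i0 j i0).
rewrite splitS.
have enumP (k : K) (T : {set K}) : k \in enum T -> k \in T by rewrite mem_enum.
have -> : \prod_(k <- enum S1) cbrt (mean offdiag (F k)) =
    \prod_(k <- enum S1) cbrt (mean [set: I] (G1 k)).
  apply: eq_big_seq => k /enumP kS; rewrite -mean_offdiag_fst; congr cbrt.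
  by apply: eq_mean => p _; exact: S1E.
have -> : \prod_(k <- enum S2) cbrt (mean offdiag (F k)) =
    \prod_(k <- enum S2) cbrt (mean [set: I] (G2 k)).
  apply: eq_big_seq => k /enumP kS; rewrite -mean_offdiag_snd; congr cbrt.
  by apply: eq_mean => p _; exact: S2E.
rewrite (@eq_mean _ _ _ _ (fun p => (\prod_(k <- enum S1) cbrt (G1 k p.1)) *
  (\prod_(k <- enum S2) cbrt (G2 k p.2)) * \prod_(k in S0) cbrt (mean offdiag (F k)))); last first.
  move=> p _; rewrite splitS; congr (_ * _ * _).
  - by apply: eq_big_seq => k /enumP kS; rewrite S1E.
  - by apply: eq_big_seq => k /enumP kS; rewrite S2E.
  - apply: eq_bigr => k kS; rewrite (@eq_mean _ _ _ _ (fun=> F k p)) ?mean_const//.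
    by move=> p' _; rewrite (S0E _ kS p') (S0E _ kS p).
rewrite meanMr ler_wpM2r//; first by rewrite prodr_ge0// => *; rewrite cbrt_ge0.
have G10 k i : 0 <= G1 k i by apply: F0.
have G20 k i : 0 <= G2 k i by apply: F0.
(* The constant 1 fills up the at most two factors of each coordinate to exactly two. *)
have pad (T : seq K) (G : K -> I -> R) : (size T <= 2)%N -> (forall k i, 0 <= G k i) ->
  exists a b : I -> R, [/\ forall i, 0 <= a i, forall i, 0 <= b i,
    forall i, \prod_(k <- T) cbrt (G k i) = cbrt (a i) * cbrt (b i) &
    \prod_(k <- T) cbrt (mean [set: I] (G k)) =
      cbrt (mean [set: I] a) * cbrt (mean [set: I] b)].
  have m1 : mean [set: I] (fun=> 1) = 1 :> R.
    by rewrite mean_const// cardsT (leq_trans _ I_ge3).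
  move=> T2 G0; case: T T2 => [|k1 [|k2 [|]]]// _.
  - exists (fun=> 1), (fun=> 1); split=> [//|//|i|];
      by rewrite ?m1 cbrt1 big_nil mulr1.
  - exists (G k1), (fun=> 1); split=> [//|//|i|];
      by rewrite ?m1 cbrt1 big_seq1 mulr1.
  - exists (G k1), (G k2); split=> [//|//|i|];
      by rewrite !big_cons big_nil mulr1.
have card_enum (T T' : {set K}) : T \subset T' -> (#|T'| <= 2)%N -> (size (enum T) <= 2)%N.
  by move=> /subset_leq_card; rewrite -cardE; apply: leq_trans.
have [a [b [a0 b0 abE ->]]] := pad _ G1 (card_enum S1 _ (subsetIr _ _) N12) G10.
have [c [d [c0 d0 cdE ->]]] := pad _ G2 (card_enum S2 _ (subsetIr _ _) N22) G20.
under eq_mean => p _ do rewrite abE cdE.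
exact: mean_hoelder_neq.
Qed.

End MatedBlock.

(** * Resampling a colouring *)

Section Resampling.
Variables (R : realFieldType) (T I : finType).
Local Notation X := {ffun T -> I}.
Implicit Types (x y : X) (i j v : T) (p : I * I) (F : X -> R) (N : {set T}).

(** The case [i = j] is allowed, and then only [p.1] counts; an unmatched vertex and a pair of mates
    are thus resampled by the same operation. *)
Definition recolor2 x i j p : X :=
  [ffun v => if v == i then p.1 else if v == j then p.2 else x v].

Definition depends_on N F := forall x y, {in N, x =1 y} -> F x = F y.

Lemma depends_onS N N' F : N \subset N' -> depends_on N F -> depends_on N' F.
Proof. by move=> /subsetP sN dF x y xy; apply: dF => v /sN /xy. Qed.

Lemma depends_on_recolor2 N F x i j p : depends_on N F -> i \notin N -> j \notin N ->
  F (recolor2 x i j p) = F x.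
Proof.
move=> dF iN jN; apply: dF => v vN; rewrite ffunE.
have [vi|_] := eqVneq v i; first by rewrite -vi vN in iN.
by have [vj|_] := eqVneq v j; first by rewrite -vj vN in jN.
Qed.

Definition resample (D : {set I * I}) i j F x := mean D (fun p => F (recolor2 x i j p)).

Lemma depends_on_resample D N F i j : depends_on N F ->
  depends_on (N :\: [set i; j]) (resample D i j F).
Proof.
move=> dF x y xy; apply: eq_mean => p _; apply: dF => v vN; rewrite !ffunE.
have [//|vi] := eqVneq v i; have [//|vj] := eqVneq v j.
by apply: xy; rewrite !inE (negPf vi) (negPf vj).
Qed.

Lemma resample_ge0 D F i j x : (forall x, 0 <= F x) -> 0 <= resample D i j F x.
Proof. by move=> F0; apply: mean_ge0. Qed.

(* Exchanging the new colours with the old ones is an involution of the pairs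
   (configuration, new colours). *)
Lemma sum_resample (Om : {set X}) (D : {set I * I}) i j F : (0 < #|D|)%N ->
  (forall x p, x \in Om -> p \in D -> recolor2 x i j p \in Om) ->
  (forall x, x \in Om -> (x i, x j) \in D) ->
  (i = j -> forall p, p \in D -> p.1 = p.2) ->
  \sum_(x in Om) F x = \sum_(x in Om) resample D i j F x.
Proof.
move=> D0 OmD DOm diagD.
pose h (z : X * (I * I)) := (recolor2 z.1 i j z.2, (z.1 i, z.1 j)).
pose P (z : X * (I * I)) := (z.1 \in Om) && (z.2 \in D).
have Ph z : P z -> P (h z) by case: z => x p /andP[/= xO pD]; rewrite /P/= OmD// DOm.
have hK z : P z -> h (h z) = z.
  case: z => x [c d] /andP[/= xO pD]; rewrite /h/=; congr (_, (_, _)).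
  - apply/ffunP => v; rewrite !ffunE/=; have [->//|vi] := eqVneq v i.
    by have [->//|//] := eqVneq v j.
  - by rewrite ffunE eqxx.
  - by rewrite ffunE eqxx; case: eqVneq => // ji; rewrite (diagD (esym ji) _ pD).
rewrite /resample /mean -mulr_suml; apply: (canRL (mulfK _)).
  by rewrite pnatr_eq0 -lt0n.
rewrite mulr_suml.
under eq_bigr => x _ do rewrite mulr_natr -sumr_const.
rewrite (pair_big_dep (mem Om) (fun _ => mem D) (fun x _ => F x))/=.
rewrite (pair_big_dep (mem Om) (fun _ => mem D) (fun x p => F (recolor2 x i j p)))/=.
rewrite (reindex_onto h h) => [|z /hK//]; apply: eq_big => //= z.
rewrite -/(P (h z)) -/(P z); apply/andP/idP => [[Phz /eqP hz]|Pz].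
  by rewrite -hz; exact: Ph.
by split; [exact: Ph | rewrite hK].
Qed.

End Resampling.

(** * Hoelder's inequality for blocks of mated coordinates *)

Section Finner.
Variables (R : realType) (T I K : finType) (m : T -> T) (A : {set T}).
Local Notation X := {ffun T -> I}.
Hypotheses (I_ge3 : (3 <= #|I|)%N) (mK : involutive m).
Hypothesis mA : forall i, i \in A -> m i \in A.

(** The coordinates outside [A] are kept and range freely; they cancel in means of functions that
    depend on [A] only. *)
Definition mates_differ : {set X} :=
  [set x : X | [forall i in A, (m i != i) ==> (x i != x (m i))]].

(** The possible colours of the block of [i] and [m i]. The single colour of an unmatched vertex is
    encoded as a diagonal pair. *)
Definition block_colors (i : T) : {set I * I} :=
  if m i == i then [set p | p.1 == p.2] else offdiag I.

Lemma block_colors_gt0 i : (0 < #|block_colors i|)%N.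
Proof.
have [c _] : exists c : I, c \in I by apply/card_gt0P; apply: leq_trans I_ge3.
rewrite /block_colors; case: ifP => _.
  by apply/card_gt0P; exists (c, c); rewrite inE.
by rewrite card_offdiag; case: #|I| I_ge3 => [|[|n]].
Qed.

Lemma mates_differP (x : X) :
  reflect (forall i, i \in A -> m i != i -> x i != x (m i)) (x \in mates_differ).
Proof.
rewrite inE; apply: (iffP forallP) => [h i iA mi|h i].
  by have := h i; rewrite iA mi.
by apply/implyP => iA; apply/implyP => mi; apply: h.
Qed.

Lemma sum_mates_differ (F : X -> R) i : i \in A ->
  \sum_(x in mates_differ) F x =
  \sum_(x in mates_differ) resample (block_colors i) i (m i) F x.
Proof.
move=> iA; apply: sum_resample => [|x p|x|].
- exact: block_colors_gt0.
- rewrite /block_colors => /mates_differP xO pD; apply/mates_differP => v vA mv.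
  rewrite !ffunE; have [vi|vi] := eqVneq v i.
    rewrite vi eqxx; have [mi|mi] := eqVneq (m i) i; first by rewrite vi mi eqxx in mv.
    by move: pD; rewrite (negPf mi) inE.
  have [vmi|vmi] := eqVneq v (m i).
    rewrite vmi mK eqxx; move: pD; case: ifP => [/eqP mi|_].
      by rewrite vmi mK mi eqxx in mv.
    by rewrite inE eq_sym.
  rewrite (inj_eq (inv_inj mK)) (negPf vi).
  have -> : (m v == i) = false by rewrite -[i]mK (inj_eq (inv_inj mK)) (negPf vmi).
  exact: xO.
- move=> /mates_differP xO; rewrite /block_colors.
  by case: eqVneq => [->|mi]; rewrite inE//= xO.
- by move=> mi p; rewrite /block_colors -mi eqxx inE => /eqP.
Qed.

Lemma resample_prod_le (S : {set K}) (N : K -> {set T}) (F : K -> X -> R) i x :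
  (forall k y, 0 <= F k y) -> (forall k, depends_on (N k) (F k)) ->
  (#|[set k in S | i \in N k]| <= if m i == i then 3 else 2)%N ->
  (#|[set k in S | m i \in N k]| <= if m i == i then 3 else 2)%N ->
  resample (block_colors i) i (m i) (fun y => \prod_(k in S) cbrt (F k y)) x <=
  \prod_(k in S) cbrt (resample (block_colors i) i (m i) (F k) x).
Proof.
move=> F0 dF Ni Nmi; have D0 := block_colors_gt0 i.
have dep k v p p' : v \notin N k -> (forall w, w \in N k -> w != v ->
   recolor2 x i (m i) p w = recolor2 x i (m i) p' w) ->
   F k (recolor2 x i (m i) p) = F k (recolor2 x i (m i) p').
  move=> vN pp; apply: dF => w wN; apply: pp => //.
  by apply: contraNneq vN => <-.
rewrite /resample; move: Ni Nmi D0; rewrite /block_colors; case: eqVneq => mi Ni Nmi D0.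
  apply: (mean_hoelder_set D0 Ni) => [k p|k kS kN p p' _ _]; first exact: F0.
  apply: (dep k i); first by apply: contra kN; rewrite inE kS.
  by move=> w _ wi; rewrite !ffunE mi (negPf wi).
apply: (mean_hoelder_block I_ge3 Ni Nmi) => [k p|k kS kN c c' d|k kS kN c d d'].
- exact: F0.
- apply: (dep k i); first by apply: contra kN; rewrite inE kS.
  by move=> w _ wi; rewrite !ffunE (negPf wi).
- apply: (dep k (m i)); first by apply: contra kN; rewrite inE kS.
  by move=> w _ wi; rewrite !ffunE (negPf wi).
Qed.

Hypothesis Om_gt0 : (0 < #|mates_differ|)%N.

(** Blocks are integrated out one at a time by [resample_prod_le]. Each step replaces every [F k] by
    its conditional mean, which no longer sees the block and has the same overall mean. *)
Lemma finner (S : {set K}) (N : K -> {set T}) (F : K -> X -> R) :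
  (forall k x, 0 <= F k x) -> (forall k, depends_on (N k) (F k)) ->
  (forall k, k \in S -> N k \subset A) ->
  (forall i, i \in A ->
    (#|[set k in S | i \in N k]| <= if m i == i then 3 else 2)%N) ->
  mean mates_differ (fun x => \prod_(k in S) cbrt (F k x)) <=
  \prod_(k in S) cbrt (mean mates_differ (F k)).
Proof.
move=> F0 dF NA degN.
(* [U] contains the coordinates not yet integrated out. The dependency sets [M k] only shrink, so
   the degree bound assumed for [N] persists. *)
suff gen n (U : {set T}) (M : K -> {set T}) (G : K -> X -> R) : (#|U| <= n)%N ->
  U \subset A -> (forall k, k \in S -> M k \subset U) -> (forall k, M k \subset N k) ->
  (forall k x, 0 <= G k x) -> (forall k, depends_on (M k) (G k)) ->
  mean mates_differ (fun x => \prod_(k in S) cbrt (G k x)) <=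
  \prod_(k in S) cbrt (mean mates_differ (G k)).
  exact: (gen #|A| A N F).
elim: n U M G => [|n IH] U M G cardU UA MU MN G0 dG.
  move: cardU; rewrite leqn0 cards_eq0 => /eqP U0.
  have Gc k x y : k \in S -> G k x = G k y.
    move=> kS; apply: dG => v vM.
    by have /subsetP/(_ v vM) := MU k kS; rewrite U0 inE.
  have [x0 _] : exists x0, x0 \in mates_differ by apply/card_gt0P.
  rewrite (@eq_mean _ _ _ _ (fun=> \prod_(k in S) cbrt (G k x0))); last first.
    by move=> x _; apply: eq_bigr => k kS; rewrite (Gc k x x0).
  rewrite mean_const// le_eqVlt; apply/orP; left; apply/eqP.
  apply: eq_bigr => k kS; rewrite (@eq_mean _ _ _ _ (fun=> G k x0)) ?mean_const//.
  by move=> x _; exact: Gc.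
have [U0|/set0Pn[i iU]] := eqVneq U set0; first by apply: (IH U M G) => //; rewrite U0 cards0.
have iA := subsetP UA _ iU.
have degM v : v \in A -> (#|[set k in S | v \in M k]| <= if m v == v then 3 else 2)%N.
  move=> vA; apply: leq_trans (degN v vA); apply: subset_leq_card.
  by apply/subsetP => k; rewrite !inE => /andP[-> /(subsetP (MN k))].
pose Ti := resample (R := R) (block_colors i) i (m i).
have meanT F' : mean mates_differ F' = mean mates_differ (Ti F').
  by rewrite /mean (sum_mates_differ F' iA).
rewrite meanT; apply: (@le_trans _ _
    (mean mates_differ (fun x => \prod_(k in S) cbrt (Ti (G k) x)))).
  apply: le_mean => x _; apply: (@resample_prod_le _ M) => //; first exact: degM.
  by have := degM _ (mA iA); rewrite mK [m i == i]eq_sym.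
under [X in _ <= X]eq_bigr do rewrite meanT.
apply: (IH (U :\: [set i; m i]) (fun k => M k :\: [set i; m i])).
- rewrite -ltnS; apply: leq_trans cardU; apply: proper_card.
  by apply/properP; split; [exact: subsetDl | exists i => //; rewrite !inE eqxx].
- by apply: subset_trans UA; exact: subsetDl.
- by move=> k kS; apply: setSD; exact: MU.
- by move=> k; apply: subset_trans (MN k); exact: subsetDl.
- by move=> k x; apply: resample_ge0.
- by move=> k; apply: depends_on_resample.
Qed.

End Finner.

Section Averaging.
Variables (R : realFieldType) (T I : finType).
Local Notation X := {ffun T -> I}.
Implicit Types (x y : X) (i j v : T) (p : I * I) (F : X -> R) (N : {set T}).

Definition recolor x v c : X := [ffun w => if w == v then c else x w].

Definition average v F x := mean [set: I] (fun c => F (recolor x v c)).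

Lemma depends_on_setT F : depends_on [set: T] F.
Proof. by move=> x y xy; congr F; apply/ffunP => v; apply: xy. Qed.

Lemma depends_on_average N F v : depends_on N F ->
  depends_on (N :\ v) (average v F).
Proof.
move=> dF x y xy; apply: eq_mean => c _; apply: dF => w wN; rewrite !ffunE.
by have [//|wv] := eqVneq w v; apply: xy; rewrite !inE wv.
Qed.

Lemma resampleM N D i j F F' x : depends_on N F -> i \notin N -> j \notin N ->
  resample D i j (fun y => F y * F' y) x = F x * resample D i j F' x.
Proof.
move=> dF iN jN; rewrite /resample -meanMl; apply: eq_mean => p _.
by rewrite (depends_on_recolor2 _ _ dF).
Qed.

Lemma depends_onM N F F' : depends_on N F -> depends_on N F' ->
  depends_on N (fun x => F x * F' x).
Proof. by move=> dF dF' x y xy; rewrite (dF x y)// (dF' x y). Qed.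

Lemma depends_on_prod (K : finType) (S : {set K}) (W : K -> {set T}) (F : K -> X -> R) N :
  (forall k, k \in S -> W k \subset N) -> (forall k, depends_on (W k) (F k)) ->
  depends_on N (fun x => \prod_(k in S) F k x).
Proof.
move=> WN dF x y xy; apply: eq_bigr => k kS; apply: dF => v vW.
exact/xy/(subsetP (WN k kS)).
Qed.

(** No factor sees the block of another one, so resampling the block of [j] affects [w j] alone, and
    the blocks can be treated in turn. *)
Lemma sum_out (Om : {set X}) (m : T -> T) (D : T -> {set I * I}) (S : {set T})
    (W : T -> {set T}) (w : T -> X -> R) :
  (forall j, j \in S -> (0 < #|D j|)%N) ->
  (forall j x p, j \in S -> x \in Om -> p \in D j -> recolor2 x j (m j) p \in Om) ->
  (forall j x, j \in S -> x \in Om -> (x j, x (m j)) \in D j) ->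
  (forall j, j \in S -> j = m j -> forall p, p \in D j -> p.1 = p.2) ->
  (forall j, depends_on (W j) (w j)) ->
  (forall j k, j \in S -> k \in S -> j != k -> (j \notin W k) && (m j \notin W k)) ->
  \sum_(x in Om) \prod_(j in S) w j x =
  \sum_(x in Om) \prod_(j in S) resample (D j) j (m j) (w j) x.
Proof.
move=> D0 OmD DOm diagD dw disjW.
(* [H] collects the factors already resampled; [N] contains the coordinates it sees and avoids the
   blocks still to come. *)
suff gen n (U N : {set T}) (H : X -> R) : #|U| = n -> U \subset S -> depends_on N H ->
  (forall j, j \in U -> (j \notin N) && (m j \notin N)) ->
  \sum_(x in Om) H x * \prod_(j in U) w j x =
  \sum_(x in Om) H x * \prod_(j in U) resample (D j) j (m j) (w j) x.
  have N0 j : j \in S -> (j \notin set0) && (m j \notin set0) by rewrite !inE.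
  have := gen _ S set0 (fun=> 1) erefl (subxx _) (fun _ _ _ => erefl) N0.
  by under eq_bigr do rewrite mul1r; under [X in _ = X -> _]eq_bigr do rewrite mul1r.
elim: n U N H => [|n IH] U N H cU US dH NU.
  have U0 : U = set0 by apply/eqP; rewrite -cards_eq0 cU.
  by apply: eq_bigr => x _; rewrite U0 !big_set0.
have /card_gt0P[j jU] : (0 < #|U|)%N by rewrite cU.
have jS := subsetP US _ jU.
have /andP[jN mjN] := NU j jU.
have dP : depends_on (\bigcup_(k in U :\ j) W k) (fun x => \prod_(k in U :\ j) w k x).
  by apply: depends_on_prod dw => k kU; exact: bigcup_sup.
have PE (a : T -> R) : \prod_(k in U) a k = a j * \prod_(k in U :\ j) a k.
  by rewrite (big_setD1 j).
have njW k : k \in U :\ j -> (j \notin W k) && (m j \notin W k).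
  by rewrite !inE => /andP[kj kU]; apply: disjW; rewrite ?(subsetP US)// eq_sym.
under eq_bigr do rewrite PE mulrCA mulrC.
under [RHS]eq_bigr do rewrite PE mulrA.
have dHr : depends_on (N :|: (W j :\: [set j; m j]))
    (fun x => H x * resample (D j) j (m j) (w j) x).
  apply: depends_onM; first exact: depends_onS (subsetUl _ _) dH.
  apply: depends_onS (subsetUr _ _) _.
  exact: (depends_on_resample (D j) (i := j) (j := m j) (dw j)).
rewrite -(IH (U :\ j) _ _ _ _ dHr); last 3 first.
- by move: cU; rewrite (cardsD1 j) jU => -[].
- by apply: subset_trans US; rewrite subD1set.
- move=> k; rewrite !inE => /andP[kj kU].
  have /andP[kN mkN] := NU k kU.
  have /andP[kW mkW] := disjW _ _ (subsetP US _ kU) jS kj.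
  by rewrite (negPf kN) (negPf mkN) (negPf kW) (negPf mkW) !andbF.
rewrite (@sum_resample _ _ _ Om (D j) j (m j)); first last.
- exact: diagD.
- by move=> x; exact: DOm.
- by move=> x p; exact: OmD.
- exact: D0.
apply: eq_bigr => x _.
rewrite (@resampleM (N :|: \bigcup_(k in U :\ j) W k)); last 3 first.
- apply: depends_onM; first exact: depends_onS (subsetUl _ _) dH.
  exact: depends_onS (subsetUr _ _) dP.
- rewrite inE negb_or jN/=; apply/bigcupP => -[k /njW/andP[kW _]].
  by rewrite (negPf kW).
- rewrite inE negb_or mjN/=; apply/bigcupP => -[k /njW/andP[_ kW]].
  by rewrite (negPf kW).
by rewrite mulrAC.
Qed.

End Averaging.

Section Mates.
Variables (R : realType) (T I : finType) (m : T -> T) (A : {set T}).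
Local Notation X := {ffun T -> I}.
Hypotheses (I_ge3 : (3 <= #|I|)%N) (mK : involutive m).
Hypothesis mA : forall i, i \in A -> m i \in A.
Local Notation Om := (mates_differ I m A).
Implicit Types (F : X -> R) (N : {set T}).

Lemma mean_block_fst v (f : I -> R) :
  mean (block_colors I m v) (fun p => f p.1) = mean [set: I] f.
Proof.
rewrite /block_colors; case: ifP => _; last exact: mean_offdiag_fst.
rewrite /mean.
have E (g : I * I -> R) : \sum_(p in [set p : I * I | p.1 == p.2]) g p = \sum_i g (i, i).
  transitivity (\sum_i \sum_(j | i == j) g (i, j)).
    rewrite (pair_big_dep predT (fun i j => i == j) (fun i j => g (i, j)))/=.
    by apply: eq_big => [p|[]//]; rewrite inE.
  by apply: eq_bigr => i _; rewrite (big_pred1 i)// => j; rewrite /= eq_sym.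
have -> : #|[set p : I * I | p.1 == p.2]| = #|[set: I]|.
  rewrite cardsT -(card_codom (f := fun i : I => (i, i))) => [|i j [//]].
  apply: eq_card => -[i j]; rewrite inE/=; apply/eqP/codomP => [->|[k [-> ->]]//].
  by exists j.
by rewrite E; congr (_ / _); apply: eq_bigl => i; rewrite inE.
Qed.

(** Each colour of a random block is uniform by itself, so forgetting the mate is exact when [F]
    does not see it. *)
Lemma sum_average N F v : v \in A -> depends_on N F -> (m v == v) || (m v \notin N) ->
  \sum_(x in Om) F x = \sum_(x in Om) average v F x.
Proof.
move=> vA dF mvN; rewrite (sum_mates_differ I_ge3 mK _ vA)//; apply: eq_bigr => x _.
rewrite /resample /average -(mean_block_fst v); apply: eq_mean => p _; apply: dF => w wN.
rewrite !ffunE; have [//|wv] := eqVneq w v; case: eqVneq => // wmv; subst w.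
by move: mvN; rewrite wN (negPf wv).
Qed.

(** The left side averages over pairs of distinct colours of [v] and [m v], the right side over all
    pairs. For each colour of [m v], the added diagonal value is at least every other value, so it
    can only raise the mean. *)
Lemma sum_average_le F v : v \in A -> (forall x, F x <= F (recolor x v (x (m v)))) ->
  \sum_(x in Om) F x <= \sum_(x in Om) average v F x.
Proof.
move=> vA Fle; have [mv|mv] := eqVneq (m v) v.
  by rewrite (sum_average vA (@depends_on_setT _ _ _ F))// mv eqxx.
(* The averaged function no longer depends on [v], so the colour of [m v] may be averaged freely as
   well. *)
rewrite [leRHS](@sum_average ([set: T] :\ v) _ (m v)); last 3 first.
- exact: mA.
- by apply: depends_on_average; exact: depends_on_setT.
- by rewrite mK !inE eqxx orbT.
rewrite (sum_mates_differ I_ge3 mK _ vA)//; apply: ler_sum => x _.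
rewrite /resample /block_colors (negPf mv) /average /mean.
rewrite sum_offdiag (exchange_big_dep predT)//=.
set G := fun c c' => F (recolor2 x v (m v) (c, c')).
have Gset c c' : F (recolor (recolor x (m v) c') v c) = G c c'.
  by congr F; apply/ffunP => w; rewrite !ffunE; case: (w == v).
have Gle c c' : G c c' <= G c' c'.
  apply: (le_trans (Fle _)); rewrite le_eqVlt; apply/orP; left; apply/eqP; congr F.
  by apply/ffunP => w; rewrite !ffunE eqxx (negPf mv); case: eqVneq.
have q0 : 0 < #|I|%:R :> R by rewrite ltr0n (leq_trans _ I_ge3).
have q1 : 0 < #|I|%:R - 1 :> R by rewrite subr_gt0 ltr1n (leq_trans _ I_ge3).
have qE : #|I|.-1%:R = #|I|%:R - 1 :> R.
  by case: #|I| I_ge3 => // n _; rewrite /= -[in RHS]addn1 natrD addrK.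
rewrite card_offdiag natrM qE.
rewrite ler_pdivrMr ?mulr_gt0// -mulr_suml cardsT.
have E (f : I -> R) : \sum_(c in [set: I]) f c = \sum_c f c by apply: eq_bigl => c; rewrite inE.
rewrite E; under [in leRHS]eq_bigr do (rewrite E; under eq_bigr do rewrite Gset).
set S := \sum_i \sum_i0 _.
have -> : S / #|I|%:R / #|I|%:R * (#|I|%:R * (#|I|%:R - 1)) = S * (#|I|%:R - 1) / #|I|%:R.
  by field; rewrite gt_eqF.
rewrite ler_pdivlMr// /S !mulr_suml; apply: ler_sum => c' _.
rewrite -/(G _ _) [X in _ <= X * _](bigD1 c')//=.
set U := \sum_(i | i != c') G i c'.
have UE : U <= (#|I|%:R - 1) * G c' c'.
  apply: (@le_trans _ _ (\sum_(i | i != c') G c' c')); first by apply: ler_sum => c _; exact: Gle.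
  rewrite (eq_bigl [pred i | c' != i]) => [|i]; last by rewrite /= eq_sym.
  by rewrite sumr_const card_neq -[leLHS]mulr_natl qE.
by nra.
Qed.

End Mates.

(** * Polynomial inequalities *)

Local Notation N := BinNums.N.

(* Polynomials with binary natural coefficients, lowest degree first. *)
Fixpoint npoly_add (a b : seq N) := match a, b with
  | [::], _ => b
  | _, [::] => a
  | c :: a', d :: b' => BinNat.N.add c d :: npoly_add a' b'
  end.

Fixpoint npoly_mul (a b : seq N) := match a with
  | [::] => [::]
  | c :: a' => npoly_add [seq BinNat.N.mul c d | d <- b] (0%num :: npoly_mul a' b)
  end.

Fixpoint npoly_exp (a : seq N) n := match n with
  | 0 => [:: 1%num]
  | n'.+1 => npoly_mul a (npoly_exp a n')
  end.

Fixpoint npoly_le (a b : seq N) := match a, b with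
  | [::], _ => true
  | c :: a', d :: b' => BinNat.N.leb c d && npoly_le a' b'
  | _ :: _, [::] => false
  end.

Section NPoly.
Variable R : realFieldType.
Implicit Types (t : R) (a b : seq N).

Fixpoint npoly_eval a t : R :=
  if a is c :: a' then (BinNat.N.to_nat c)%:R + t * npoly_eval a' t else 0.

Lemma npoly_evalD a b t :
  npoly_eval (npoly_add a b) t = npoly_eval a t + npoly_eval b t.
Proof.
elim: a b => [|c a IH] [|d b] /=; rewrite ?add0r ?addr0//.
by rewrite IH Nnat.N2Nat.inj_add plusE natrD; ring.
Qed.

Lemma npoly_evalM a b t :
  npoly_eval (npoly_mul a b) t = npoly_eval a t * npoly_eval b t.
Proof.
elim: a => [|c a IH] /=; first by rewrite mul0r.
rewrite npoly_evalD /= IH add0r.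
suff -> : npoly_eval [seq BinNat.N.mul c d | d <- b] t = (BinNat.N.to_nat c)%:R * npoly_eval b t.
  by ring.
elim: b {IH} => [|d b IHb] /=; rewrite ?mulr0// IHb Nnat.N2Nat.inj_mul multE natrM; ring.
Qed.

Lemma npoly_evalX a n t : npoly_eval (npoly_exp a n) t = npoly_eval a t ^+ n.
Proof.
elim: n => [|n IH] /=; first by rewrite mulr0 addr0 expr0.
by rewrite npoly_evalM IH exprS.
Qed.

Lemma npoly_eval_ge0 a t : 0 <= t -> 0 <= npoly_eval a t.
Proof. by move=> t0; elim: a => //= c a IH; rewrite addr_ge0// mulr_ge0. Qed.

Lemma le_npoly_eval a b t : 0 <= t -> npoly_le a b ->
  npoly_eval a t <= npoly_eval b t.
Proof.
move=> t0; elim: a b => [|c a IH] [|d b]//=; first by rewrite addr_ge0 ?mulr_ge0 ?npoly_eval_ge0.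
move=> /andP[/BinNat.N.leb_le cd /IH ab]; rewrite lerD//; last by rewrite ler_wpM2l.
by rewrite ler_nat -(BinNat.N.sub_add _ _ cd) Nnat.N2Nat.inj_add leq_addl.
Qed.

End NPoly.

Section Inequalities.
Variable R : realFieldType.
Implicit Types t q : R.

(** The three terms correspond to one, two or three colours on one side of [K_{3,3}]; the cube
    counts the choices for the other side. *)
Definition chrom_K33 q := q * (q - 1) ^+ 3 + 3 * q * (q - 1) * (q - 2) ^+ 3
  + q * (q - 1) * (q - 2) * (q - 3) ^+ 3.

(* The bounds below are checked coefficientwise in [t = q - 3]. *)
Let chrom_K33_npoly : seq N := [:: 42; 113; 132; 87; 36; 9; 1]%num.

Let chrom_K33E t : chrom_K33 (t + 3) = npoly_eval chrom_K33_npoly t.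
Proof. by rewrite /chrom_K33 /= /PosDef.Pos.to_nat /=; ring. Qed.

Let npolyX t : t + 3 = npoly_eval [:: 3; 1]%num t.
Proof. by rewrite /= /PosDef.Pos.to_nat /=; ring. Qed.

Lemma edge_density_lt q : 3 <= q -> (q - 1) ^+ 9 < chrom_K33 q * q ^+ 3.
Proof.
rewrite -subr_ge0; move E : (q - 3) => t t0.
have -> : q = t + 3 by rewrite -E subrK.
rewrite chrom_K33E [in ltRHS]npolyX (_ : t + 3 - 1 = npoly_eval [:: 2; 1]%num t); last first.
  by rewrite /= /PosDef.Pos.to_nat /=; ring.
rewrite -!npoly_evalX -npoly_evalM.
(* Adding 1 to the smaller side gives strictness, as the coefficientwise comparison only yields a
   weak inequality. *)
apply: (@lt_le_trans _ _ (npoly_eval (npoly_add [:: 1%num] (npoly_exp [:: 2; 1]%num 9)) t)).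
  by rewrite npoly_evalD [npoly_eval [:: _] t]/= mulr0 addr0 ltrDr ltr01.
by apply: le_npoly_eval => //; vm_compute.
Qed.

(* [shared_bound q / q ^+ 7] and [path_bound q / q ^+ 8] bound the third moment of
   the factor of an edge inside the cut whose ends have, respectively do not have,
   a common neighbour. *)
Definition shared_bound q :=
  (q - 1) * ((q - 2) ^+ 2 - (q - 3)) ^+ 3 + ((q - 1) * (q - 2)) ^+ 3.

Let shared_bound_npoly := npoly_add
  (npoly_mul [:: 2; 1]%num (npoly_exp [:: 1; 1; 1]%num 3)) (npoly_exp [:: 2; 3; 1]%num 3).

Let shared_boundE t : shared_bound (t + 3) = npoly_eval shared_bound_npoly t.
Proof.
rewrite npoly_evalD npoly_evalM !npoly_evalX /shared_bound /= /PosDef.Pos.to_nat /=.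
by ring.
Qed.

Lemma shared_bound_ge0 q : 3 <= q -> 0 <= shared_bound q.
Proof. by move=> q3; rewrite -(subrK 3 q) shared_boundE npoly_eval_ge0// subr_ge0. Qed.

Lemma shared_bound_le q : 3 <= q -> shared_bound q ^+ 3 * q ^+ 9 <= chrom_K33 q ^+ 5.
Proof.
rewrite -subr_ge0; move E : (q - 3) => t t0.
have -> : q = t + 3 by rewrite -E subrK.
rewrite shared_boundE chrom_K33E npolyX -!npoly_evalX -npoly_evalM.
by apply: le_npoly_eval => //; vm_compute.
Qed.

Definition path_bound q :=
  ((q - 1) ^+ 2 - (q - 2)) ^+ 3 + 2 * ((q - 2) ^+ 2) ^+ 3
  + 2 * (q - 2) * ((q - 1) * (q - 2) - (q - 3)) ^+ 3
  + ((q - 2) ^+ 2 - (q - 2)) ^+ 3 + 2 * (q - 2) * ((q - 2) ^+ 2 - (q - 3)) ^+ 3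
  + (q - 2) ^+ 2 * ((q - 2) ^+ 2 - (q - 4)) ^+ 3.

Let path_bound_npoly : seq N := [:: 55; 193; 326; 345; 248; 124; 42; 9; 1]%num.

Let path_boundE t : path_bound (t + 3) = npoly_eval path_bound_npoly t.
Proof. by rewrite /path_bound /= /PosDef.Pos.to_nat /=; ring. Qed.

Lemma path_bound_ge0 q : 3 <= q -> 0 <= path_bound q.
Proof. by move=> q3; rewrite -(subrK 3 q) path_boundE npoly_eval_ge0// subr_ge0. Qed.

Lemma path_bound_le q : 3 <= q -> path_bound q ^+ 3 * q ^+ 6 <= chrom_K33 q ^+ 5.
Proof.
rewrite -subr_ge0; move E : (q - 3) => t t0.
have -> : q = t + 3 by rewrite -E subrK.
rewrite path_boundE chrom_K33E npolyX -!npoly_evalX -npoly_evalM.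
by apply: le_npoly_eval => //; vm_compute.
Qed.

End Inequalities.

Section ColorCounts.
Variables (R : realFieldType) (I : finType).
Implicit Types a b c d : I.
Local Notation q := (#|I|%:R : R).

Definition free3 a b c := #|~: [set a; b; c]|.

(** The number of proper colourings of an edge whose ends have further neighbours coloured [a], [b]
    and [c], [d] respectively. *)
Definition free22 a b c d :=
  #|[set p : I * I | [&& p.1 != p.2, p.1 \notin [set a; b] & p.2 \notin [set c; d]]]|.

Lemma sum_eq1 (f : bool -> R) a :
  \sum_c f (c == a) = f true + (q - 1) * f false.
Proof.
rewrite (bigD1 a)//= eqxx; congr (_ + _).
rewrite (eq_bigr (fun=> f false)) => [|c /negPf -> //].
rewrite (eq_bigl (mem (~: [set a]))) => [|c]; last by rewrite !inE.
rewrite sumr_const -[LHS]mulr_natl cardsC1; congr (_ * _).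
by rewrite -subn1 natrB//; apply/card_gt0P; exists a.
Qed.

Lemma sum_eq2 (f : bool -> bool -> R) a b : a != b ->
  \sum_c f (c == a) (c == b) =
  f true false + f false true + (q - 2) * f false false.
Proof.
move=> ab; rewrite (bigD1 a)//= (bigD1 b) 1?eq_sym//= !eqxx [b == a]eq_sym (negPf ab).
rewrite addrA; congr (_ + _).
rewrite (eq_bigr (fun=> f false false)) => [|c /andP[/negPf -> /negPf ->]//].
rewrite (eq_bigl (mem (~: [set a; b]))) => [|c]; last by rewrite !inE negb_or.
rewrite sumr_const -[LHS]mulr_natl cardsCs setCK cards2 ab; congr (_ * _).
by rewrite natrB// -[2%N]/(true.+1) -ab -cards2 max_card.
Qed.

Lemma cards_setC (S : {set I}) : #|~: S|%:R = q - #|S|%:R.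
Proof. by rewrite -(cardsC S) natrD addrAC subrr add0r. Qed.

Lemma free3E a b c : (free3 a b c)%:R = q - 1 - (b != a)%:R - ((c != a) && (c != b))%:R :> R.
Proof.
rewrite /free3 setUC cards_setC.
rewrite cardsU1 cards2 !inE negb_or [a == b]eq_sym natrD [_.+1%:R]mulrS.
by case: (_ == _); case: (_ == _); case: (_ == _); rewrite /=; ring.
Qed.

Lemma free3_le a b c a' b' c' : [set a'; b'; c'] \subset [set a; b; c] ->
  (free3 a b c <= free3 a' b' c')%N.
Proof. by move=> sub; rewrite subset_leq_card// setCS. Qed.

Lemma sum_free3 : \sum_a \sum_b \sum_c (free3 a b c)%:R ^+ 3 = chrom_K33 q.
Proof.
have E a : \sum_b \sum_c (free3 a b c)%:R ^+ 3 =
   (q - 1) ^+ 3 + (q - 1) * (q - 2) ^+ 3 +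
   (q - 1) * (2 * (q - 2) ^+ 3 + (q - 2) * (q - 3) ^+ 3) :> R.
  pose g (e : bool) : R := if e then (q - 1) ^+ 3 + (q - 1) * (q - 2) ^+ 3
    else 2 * (q - 2) ^+ 3 + (q - 2) * (q - 3) ^+ 3.
  rewrite (eq_bigr (fun b => g (b == a))) ?sum_eq1 ?addrA// => b _.
  under eq_bigr do rewrite free3E.
  have [->|ba] := eqVneq b a.
    pose f (e : bool) : R := (q - 1 - (~~ e)%:R) ^+ 3.
    rewrite (eq_bigr (fun c => f (c == a))) => [|c _]; last by rewrite andbb /= subr0.
    by rewrite sum_eq1 /g /f /=; ring.
  pose f (e e' : bool) : R := (q - 1 - 1 - (~~ e && ~~ e')%:R) ^+ 3.
  rewrite (eq_bigr (fun c => f (c == a) (c == b))) => [|c _]; last by [].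
  by rewrite sum_eq2 1?eq_sym// /f /g /=; ring.
rewrite (eq_bigr _ (fun a _ => E a)) sumr_const -[LHS]mulr_natl /chrom_K33; ring.
Qed.

(** Independent choices at the two ends, minus the choices of one common colour. The subtracted
    bracket is [q] minus the number of distinct colours among the four. *)
Lemma free22E a b c d : (free22 a b c d)%:R =
  (q - 1 - (b != a)%:R) * (q - 1 - (d != c)%:R) -
  (q - 1 - (b != a)%:R - ((c != a) && (c != b))%:R
     - [&& d != a, d != b & d != c]%:R) :> R.
Proof.
have -> : free22 a b c d = (#|~: [set a; b]| * #|~: [set c; d]| - #|~: ([set a; b] :|: [set c; d])|)%N.
  rewrite -cardsX -(card_imset (mem (~: ([set a; b] :|: [set c; d]))) (f := fun x => (x, x))) => [|x y []//].
  rewrite -cardsDS; last first.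
    by apply/subsetP => _ /imsetP[x xP ->]; move: xP; rewrite !inE !negb_or => /andP[-> ->].
  apply: eq_card => -[x y]; rewrite !inE/=.
  have -> : ((x, y) \in [set (x, x) | x in mem (~: ([set a; b] :|: [set c; d]))]) =
      (x == y) && (x \in ~: ([set a; b] :|: [set c; d])).
    apply/imsetP/andP => [[z zP [-> ->]]|[/eqP -> xP]]; first by rewrite eqxx.
    by exists y.
  rewrite !inE; case: eqVneq => //= ->; rewrite ?andbF//.
  by rewrite negbK -negb_or andbN.
have le2 : (#|~: ([set a; b] :|: [set c; d])| <= #|~: [set a; b]| * #|~: [set c; d]|)%N.
  rewrite -cardsX -(card_imset (mem (~: ([set a; b] :|: [set c; d]))) (f := fun x => (x, x))) => [|x y []//].
  apply: subset_leq_card.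
  by apply/subsetP => _ /imsetP[x xP ->]; move: xP; rewrite !inE !negb_or => /andP[-> ->].
rewrite natrB// natrM.
have C2 (x y : I) : (#|~: [set x; y]|)%:R = q - 1 - (y != x)%:R :> R.
  by rewrite cards_setC cards2 [x == y]eq_sym -[(y != x).+1]addn1 natrD; ring.
have C4 : (#|~: ([set a; b] :|: [set c; d])|)%:R = q - 1 - (b != a)%:R
    - ((c != a) && (c != b))%:R - [&& d != a, d != b & d != c]%:R :> R.
  have -> : [set a; b] :|: [set c; d] = d |: (c |: [set a; b]).
    apply/setP => x; rewrite !inE.
    by case: (x == a); case: (x == b); case: (x == c); case: (x == d).
  rewrite cards_setC cardsU1 [#|c |: _|]cardsU1 cards2 !inE !negb_or [a == b]eq_sym.
  rewrite -[(b != a).+1]addn1 !natrD.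
  by case: (d == a); case: (d == b); case: (d == c); case: (c == a); case: (c == b); rewrite /=; ring.
by rewrite !C2 C4.
Qed.

Lemma free22_eq_le a b c d : (free22 a b c d <= free22 a a c d)%N.
Proof.
rewrite /free22 subset_leq_card//; apply/subsetP => x; rewrite !inE.
by case: (x.1 == a); rewrite ?andbF//= => /and3P[-> _ ->].
Qed.

Lemma free22C a b c d : free22 a b c d = free22 b a c d.
Proof. by rewrite /free22 [[set a; b]]setUC. Qed.

Lemma free22_swap a b c d : free22 a b c d = free22 c d a b.
Proof.
rewrite /free22 -(card_imset _ (f := fun p : I * I => (p.2, p.1))) => [|[x y] [x' y'] [-> ->]//].
apply: eq_card => -[x y]; rewrite inE/=; apply/imsetP/idP => [[[x' y'] + [-> ->]]|h].
  by rewrite inE/= eq_sym => /and3P[-> -> ->].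
exists (y, x) => //; rewrite inE/= eq_sym.
by move: h => /and3P[-> -> ->].
Qed.

Hypothesis I_ge3 : (3 <= #|I|)%N.

Let le_cube (x y : R) : 0 <= x -> x <= y -> x ^+ 3 <= y ^+ 3.
Proof. by move=> x0 xy; rewrite lerXn2r ?nnegrE ?(le_trans x0). Qed.

(* The secant of the cube between the two extreme values of [free22]. *)
Lemma free22_shared_le a b d :
  (free22 a b a d)%:R ^+ 3 <= ((q - 2) ^+ 2 - (q - 3)) ^+ 3 +
    (((q - 1) * (q - 2)) ^+ 3 - ((q - 2) ^+ 2 - (q - 3)) ^+ 3) *
    (((b == a)%:R + (d == a)%:R) / 2) :> R.
Proof.
pose t := q - 3; have qE : q = t + 3 by rewrite subrK.
have t0 : 0 <= t by rewrite subr_ge0 ler_nat.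
have := free22E a b a d; have := ler0n R (free22 a b a d).
move: (_%:R) => g g0; rewrite eqxx /= subr0; case: (eqVneq b a) => [->|ba]; last first.
  case: (eqVneq d a) => [->|da] gE.
    rewrite {}gE /= qE -subr_ge0 (_ : _ - _ =
      (7 + 27 * t + 42 * t ^+ 2 + 30 * t ^+ 3 + 9 * t ^+ 4) / 2); last by field.
    by rewrite divr_ge0// !addr_ge0// mulr_ge0// exprn_ge0.
  rewrite /= addr0 mul0r mulr0 addr0; apply: le_cube => //; rewrite gE.
  by case: (_ && _); rewrite /= qE; nra.
case: (eqVneq d a) => [_|da] gE.
  by rewrite gE /= -subr_ge0 le_eqVlt; apply/orP; left; apply/eqP; field.
rewrite {}gE /= qE -subr_ge0 (_ : _ - _ =
  (7 + 27 * t + 42 * t ^+ 2 + 30 * t ^+ 3 + 9 * t ^+ 4) / 2); last by field.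
by rewrite divr_ge0// !addr_ge0// mulr_ge0// exprn_ge0.
Qed.

(** The terms of [path_bound] classify [b] and [d] by equality with [a] and [c]. They are exact,
    except when both avoid [a] and [c]: there the value for [b != d] also serves as a bound for
    [b = d]. *)
Lemma sum_free22_le a c : a != c ->
  \sum_b \sum_d (free22 a b c d)%:R ^+ 3 <= path_bound q.
Proof.
move=> ac; pose t := q - 3; have qE : q = t + 3 by rewrite subrK.
have t0 : 0 <= t by rewrite subr_ge0 ler_nat.
(* [e], [e'] tell whether [b], respectively [d], is [a] and [c]. *)
pose f (e e' : bool * bool) : R := match e, e' with
  | (true, _), (_, true) => ((q - 1) ^+ 2 - (q - 2)) ^+ 3
  | (true, _), (true, _) | (_, true), (_, true) => ((q - 2) ^+ 2) ^+ 3
  | (true, _), _ | _, (_, true) => ((q - 1) * (q - 2) - (q - 3)) ^+ 3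
  | (_, true), (true, _) => ((q - 2) ^+ 2 - (q - 2)) ^+ 3
  | (_, true), _ | _, (true, _) => ((q - 2) ^+ 2 - (q - 3)) ^+ 3
  | _, _ => ((q - 2) ^+ 2 - (q - 4)) ^+ 3
  end.
have fE b d : (free22 a b c d)%:R ^+ 3 <= f (b == a, b == c) (d == a, d == c).
  have := free22E a b c d; have := ler0n R (free22 a b c d).
  move: (_%:R) => g g0; rewrite [c == b]eq_sym.
  have nac x : (x == a) && (x == c) = false.
    by apply/negP => /andP[/eqP -> /eqP E]; rewrite E eqxx in ac.
  have db1 : b == a -> (d == b) = (d == a) by move=> /eqP ->.
  have db2 : b == c -> (d == b) = (d == c) by move=> /eqP ->.
  rewrite [c == a]eq_sym (negPf ac); move: db1 db2 (nac b) (nac d).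
  case: (b == a); case: (b == c); case: (d == a); case: (d == c); case: (d == b) => //=;
    (try by move=> /(_ isT)); (try by move=> _ /(_ isT));
    by move=> _ _ _ _ gE; apply: le_cube => //; rewrite gE qE; nra.
have -> : path_bound q = \sum_b \sum_d f (b == a, b == c) (d == a, d == c).
  under eq_bigr => b _ do rewrite (sum_eq2 (fun e e' => f (b == a, b == c) (e, e')) ac).
  pose h (e e' : bool) := f (e, e') (true, false) + f (e, e') (false, true)
    + (q - 2) * f (e, e') (false, false).
  rewrite (eq_bigr (fun b => h (b == a) (b == c)))// sum_eq2// /h /f /path_bound; ring.
by apply: ler_sum => b _; apply: ler_sum => d _.
Qed.
End ColorCounts.

(** * The factors of the colouring sum *)

Lemma prod_bool (R : pzSemiRingType) (J : finType) (S : {set J}) (b : J -> bool) :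
  \prod_(j in S) (b j)%:R = [forall j in S, b j]%:R :> R.
Proof.
rewrite -(big_morph (fun c : bool => c%:R : R) (id2 := true) (op2 := andb)) => [|[] []|//].
- by rewrite big_andE.
all: by rewrite ?mulr1 ?mulr0 ?mul0r.
Qed.

Section CutBound.
Variables (R : realType) (G : sgraph) (A : {set G}) (k : nat).
Local Notation I := 'I_k.
Local Notation X := {ffun G -> 'I_k}.
Hypotheses (k_ge3 : (3 <= k)%N) (G_cubic : regular 3 G) (A_good : good_cut A).
Local Notation q := (k%:R : R).

Let mono_le1 v : (mono_degree A v <= 1)%N. Proof. exact: (proj1 A_good). Qed.
Let I_ge3 : (3 <= #|'I_k|)%N. Proof. by rewrite card_ord. Qed.
Local Notation m := (mate A).
Local Notation mK := (mateK mono_le1).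
Local Notation Om := (mates_differ 'I_k m A).

Let mA i : i \in A -> m i \in A. Proof. by rewrite (mate_side mono_le1). Qed.

Let m_inj : injective m. Proof. exact: inv_inj mK. Qed.

(* The part of the cut opposite to [A] is processed in blocks [{j, m j}], each
   represented by its vertex of smaller rank. *)
Definition reps : {set G} := [set j | (j \notin A) && (enum_rank j <= enum_rank (m j))%N].

Lemma reps_neq j j' : j \in reps -> j' \in reps -> j != j' -> j != m j'.
Proof.
rewrite !inE => /andP[_ jr] /andP[_ j'r]; apply: contra => /eqP jE.
rewrite jE mK in jr; have /eqP : enum_rank j' = enum_rank (m j').
  by apply/val_inj/eqP; rewrite eqn_leq /= j'r.
by rewrite (inj_eq enum_rank_inj) jE eq_sym.
Qed.

Definition rep v := if v \in reps then v else m v.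

Definition block_ok j (x : X) : bool :=
  [forall u, (edge j u ==> (x j != x u)) && (edge (m j) u ==> (x (m j) != x u))].

Definition block_nbrs j : {set G} :=
  [set v | [|| v == j, v == m j, edge j v | edge (m j) v]].

Definition block_boundary j := block_nbrs j :\: [set j; m j].

(** Unlike in [block_colors], mates get all pairs of colours: the condition that they differ is part
    of [block_ok], whereas in [A] it is built into [Om]. *)
Definition block_palette j : {set I * I} :=
  if m j == j then block_colors I m j else [set: I * I].

Definition block_density j : X -> R :=
  resample (block_palette j) j (m j) (fun x => (block_ok j x)%:R).

Lemma block_ok_dep j : depends_on (block_nbrs j) (fun x => (block_ok j x)%:R : R).
Proof.
move=> x y xy; congr (nat_of_bool _)%:R; apply: eq_forallb => u.
have -> : x j = y j by apply: xy; rewrite inE eqxx.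
have -> : x (m j) = y (m j) by apply: xy; rewrite inE eqxx orbT.
by congr (_ && _); case: (boolP (edge _ u)) => //= e; rewrite xy// inE e ?orbT.
Qed.

Lemma block_density_dep j : depends_on (block_boundary j) (block_density j).
Proof. exact/depends_on_resample/block_ok_dep. Qed.

Lemma block_density_ge0 j x : 0 <= block_density j x.
Proof. by apply: resample_ge0. Qed.

Lemma block_boundary_sub j : j \in reps -> block_boundary j \subset A.
Proof.
rewrite inE => /andP[jA _]; apply/subsetP => v; rewrite !inE negb_or.
move=> /andP[/andP[vj vm]]; rewrite (negPf vj) (negPf vm)/= => /orP[e|e].
  by rewrite (edge_cross mono_le1 e vm).
by rewrite (edge_cross mono_le1 e) ?mK// (mate_side mono_le1).
Qed.

Lemma in_boundary j v : j \in reps ->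
  (v \in block_boundary j) = (v \in A) && (edge j v || edge (m j) v).
Proof.
move=> jr; apply/idP/andP => [vb|[vA e]].
  split; first exact: (subsetP (block_boundary_sub jr)).
  by move: vb; rewrite !inE negb_or => /andP[/andP[/negPf -> /negPf ->]].
have jA : j \notin A by move: jr; rewrite inE => /andP[].
rewrite !inE negb_or; case/orP: e => -> ; rewrite ?orbT andbT.
  all: by apply/andP; split; apply: contraTneq vA => ->; rewrite ?(mate_side mono_le1).
Qed.

(** A colouring is proper when it lies in [Om] and every block outside [A] is fine. These blocks do
    not see each other, so [sum_out] replaces each indicator by its conditional probability given
    the colours of [A]. *)
Lemma num_coloringsE : (num_colorings k G)%:R =
  \sum_(x in Om) \prod_(j in reps) block_density j x.
Proof.
rewrite -(@sum_out R G I Om m block_palette reps block_nbrs); first last.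
- move=> j j' jr j'r jj'.
  have jm := reps_neq jr j'r jj'.
  have mjj' : m j != j' by apply: contraNneq jm => <-; rewrite mK.
  have mjm : m j != m j' by rewrite (inj_eq m_inj).
  have sameside v w : v \in [:: j; m j] -> w \in [:: j'; m j'] -> v != m w -> ~~ edge w v.
    move=> vj wj' vw; apply/negP => /(edge_cross mono_le1)/(_ vw).
    have jA : j \notin A by move: jr; rewrite inE => /andP[].
    have j'A : j' \notin A by move: j'r; rewrite inE => /andP[].
    have -> : v \in A = false.
      by move: vj; rewrite !inE => /orP[] /eqP ->; rewrite ?(mate_side mono_le1); apply: negPf.
    by move: wj'; rewrite !inE => /orP[] /eqP ->; rewrite ?(mate_side mono_le1) j'A.
  rewrite !inE !negb_or jj' jm mjj' mjm /=.
  by rewrite !sameside ?inE ?eqxx ?orbT// ?mK.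
- exact: block_ok_dep.
- move=> j jr jm p; rewrite /block_palette -jm eqxx /block_colors -jm eqxx inE.
  by move/eqP.
- move=> j x jr xO; rewrite /block_palette /block_colors.
  by case: eqVneq => [->|_]; rewrite inE//=.
- move=> j x p jr /mates_differP xO pD; apply/mates_differP => i iA mi.
  have jA : j \notin A by move: jr; rewrite inE => /andP[].
  have ni v : v \in A -> (v == j = false) /\ (v == m j = false).
    move=> vA; split; apply/negP => /eqP vE; rewrite vE ?(mate_side mono_le1) in vA.
      by rewrite vA in jA.
    by rewrite vA in jA.
  have [i1 i2] := ni i iA; have [i3 i4] := ni (m i) (mA iA).
  by rewrite !ffunE i1 i2 i3 i4; apply: xO.
- move=> j jr; rewrite /block_palette; case: ifP => _; first exact: block_colors_gt0.
  by rewrite cardsT card_prod muln_gt0 card_ord (leq_trans _ k_ge3).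
rewrite /num_colorings -sum1_card natr_sum big_mkcond [RHS]big_mkcond /=.
apply: eq_bigr => x _; rewrite inE prod_bool.
suff -> : proper_coloring x = (x \in Om) && [forall j in reps, block_ok j x].
  by case: (x \in Om); case: [forall j in reps, _].
apply/forallP/andP => [xP|[/mates_differP xO /forall_inP xB] u].
  have xe u v : edge u v -> x u != x v by move/forallP/(_ v)/implyP: (xP u).
  split; first by apply/mates_differP => i iA /(edge_mate mono_le1)/xe.
  apply/forall_inP => j _; apply/forallP => u.
  by apply/andP; split; apply/implyP => /xe.
have xB' j w : j \notin A -> edge j w -> x j != x w.
  move=> jA e; have [jr|jr] := boolP (j \in reps).
    by have /forallP/(_ w)/andP[/implyP/(_ e)] := xB j jr.
  have mjr : m j \in reps.
    move: jr; rewrite !inE (mate_side mono_le1) jA mK /= -ltnNge; exact: ltnW.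
  by have /forallP/(_ w)/andP[_] := xB _ mjr; rewrite mK e.
apply/forallP => v; apply/implyP => e.
have [uA|uA] := boolP (u \in A); last exact: xB'.
have [vA|vA] := boolP (v \in A); last by rewrite eq_sym xB'// edge_sym.
have [vE|vE] := eqVneq v (m u); last by rewrite (edge_cross mono_le1 e vE) uA in vA.
by rewrite vE; apply: xO => //; rewrite -vE; apply: contraTneq e => ->; rewrite edge_irrefl.
Qed.

Lemma rep_mate j : j \in reps -> rep (m j) = j.
Proof.
move=> jr; rewrite /rep mK; case: ifP => // mjr.
by apply/eqP/negPn/negP => mj; have := reps_neq mjr jr mj; rewrite eqxx.
Qed.

(** A block that sees [i] contains a neighbour of [i] across the cut, and is the [rep] of that
    neighbour; [card_cross] counts these neighbours. *)
Lemma boundary_degree i : i \in A ->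
  (#|[set j in reps | i \in block_boundary j]| <= if m i == i then 3 else 2)%N.
Proof.
move=> iA; rewrite -(card_cross mono_le1 (G_cubic i)).
apply: (@leq_trans #|rep @: [set v | edge i v && (v != m i)]|); last exact: leq_imset_card.
apply/subset_leq_card/subsetP => j; rewrite inE => /andP[jr].
have jA : j \notin A by move: jr; rewrite inE => /andP[].
rewrite in_boundary// iA /= => /orP[] e; apply/imsetP.
  exists j; last by rewrite /rep jr.
  by rewrite inE edge_sym e; apply: contraNneq jA => ->; exact: mA.
exists (m j); last by rewrite rep_mate.
by rewrite inE edge_sym e (inj_eq m_inj); apply: contraNneq jA => ->.
Qed.

Lemma Om_gt0 : (0 < #|Om|)%N.
Proof.
pose c0 : 'I_k := Ordinal (ltn_trans (isT : 0 < 2)%N k_ge3).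
pose c1 : 'I_k := Ordinal (ltn_trans (isT : 1 < 2)%N k_ge3).
apply/card_gt0P; exists [ffun v => if (enum_rank v < enum_rank (m v))%N then c0 else c1].
apply/mates_differP => i iA mi; rewrite !ffunE mK.
case: ltngtP => // E; case/eqP: mi; apply/esym/enum_rank_inj/val_inj; exact: E.
Qed.

Lemma num_colorings_le :
  (num_colorings k G)%:R <= #|Om|%:R *
    \prod_(j in reps) cbrt (mean Om (fun x => block_density j x ^+ 3)).
Proof.
rewrite num_coloringsE mulrC -ler_pdivrMr ?ltr0n ?Om_gt0// -/(mean _ _).
apply: le_trans (@finner R G 'I_k G m A I_ge3 mK mA Om_gt0 reps block_boundary
  (fun j x => block_density j x ^+ 3) _ _ block_boundary_sub boundary_degree).
- by apply: le_mean => x _; apply: ler_prod => j _; rewrite cbrtX block_density_ge0/=.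
- by move=> j x; rewrite exprn_ge0// block_density_ge0.
- by move=> j x y xy; rewrite (block_density_dep xy).
Qed.

Definition pairs (S : {set G}) := [set i in S | (enum_rank i < enum_rank (m i))%N].
Definition singles (S : {set G}) := [set i in S | m i == i].

(** The pairs of [A] are disjoint, so [sum_out] applies to their indicators, each of mean
    [1 - q^-1]. *)
Lemma card_Om : #|Om|%:R = q ^+ #|G| * (1 - q^-1) ^+ #|pairs A| :> R.
Proof.
pose w i (x : X) : R := (x i != x (m i))%:R.
have q_neq0 : q != 0 by rewrite pnatr_eq0 -lt0n (leq_trans _ k_ge3).
have pairsP i : i \in pairs A -> i != m i.
  by rewrite inE => /andP[_]; apply: contraTneq => <-; rewrite ltnn.
have pairs_neq i j : i \in pairs A -> j \in pairs A -> i != j -> i != m j.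
  rewrite !inE => /andP[_ ri] /andP[_ rj] ij; apply: contraTneq ri => ->.
  by rewrite mK -leqNgt ltnW.
transitivity (\sum_(x in [set: X]) \prod_(i in pairs A) w i x).
  rewrite -sum1_card natr_sum big_mkcond [RHS]big_mkcond/=; apply: eq_bigr => x _.
  rewrite in_setT prod_bool.
  suff -> : (x \in Om) = [forall i in pairs A, x i != x (m i)] by case: forall_inP.
  apply/mates_differP/forall_inP => [xO i iP|xP i iA mi].
    by apply: xO; [move: iP; rewrite inE => /andP[] | rewrite eq_sym pairsP].
  case: (ltngtP (enum_rank i) (enum_rank (m i))) => [r|r|/val_inj/enum_rank_inj E].
  - by apply: xP; rewrite inE iA.
  - by rewrite eq_sym -{2}[i]mK; apply: xP; rewrite inE mA// mK.
  - by rewrite -E eqxx in mi.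
rewrite (@sum_out R G 'I_k [set: X] m (fun=> [set: 'I_k * 'I_k]) (pairs A)
  (fun i => [set i; m i])); first last.
- move=> i j iP jP ij; rewrite !inE (negPf ij) (negPf (pairs_neq i j iP jP ij)).
  by rewrite (inj_eq m_inj) (negPf ij) !orbF [m i == j]eq_sym pairs_neq// eq_sym.
- by move=> i x y xy; rewrite /w !xy ?inE ?eqxx ?orbT.
- by move=> i /pairsP /eqP.
- by move=> *; rewrite inE.
- by move=> *; rewrite inE.
- by move=> *; rewrite cardsT card_prod muln_gt0 card_ord (leq_trans _ k_ge3).
rewrite (eq_bigr (fun=> (1 - q^-1) ^+ #|pairs A|)) => [|x _].
  by rewrite sumr_const cardsT card_ffun card_ord -natrX mulr_natl.
rewrite -prodr_const; apply: eq_bigr => i iP.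
have E : \sum_(p in [set: 'I_k * 'I_k]) w i (recolor2 x i (m i) p) = #|offdiag 'I_k|%:R.
  rewrite -sum1_card natr_sum [RHS]big_mkcond/= big_mkcond/=; apply: eq_bigr => p _.
  rewrite in_setT inE /w !ffunE !eqxx [m i == i]eq_sym (negPf (pairsP i iP)).
  by case: eqP.
rewrite /resample /mean E card_offdiag cardsT card_prod card_ord !natrM.
have -> : k.-1%:R = q - 1 by case: (k) k_ge3 => // n _; rewrite /= -[in RHS]addn1 natrD addrK.
by field.
Qed.

End CutBound.

Lemma cards3P (T : finType) (S : {set T}) : #|S| = 3 ->
  exists a b c, [/\ a != b, a != c, b != c & S = [set a; b; c]].
Proof.
move=> S3; have /card_gt0P[a aS] : (0 < #|S|)%N by rewrite S3.
have /eqP/cards2P[b [c [bc SE]]] : #|S :\ a| = 2.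
  by move: S3; rewrite (cardsD1 a) aS => -[].
have bS : b \in S :\ a by rewrite SE !inE eqxx.
have cS : c \in S :\ a by rewrite SE !inE eqxx orbT.
exists a, b, c; split=> //.
- by move: bS; rewrite !inE eq_sym => /andP[].
- by move: cS; rewrite !inE eq_sym => /andP[].
- by rewrite -setUA -SE setD1K.
Qed.

(** * Third moments of the factors under the correlated colours of [A] *)

Section BlockMoments.
Variables (R : realType) (T : finType) (k : nat) (m : T -> T) (A : {set T}).
Local Notation X := {ffun T -> 'I_k}.
Local Notation q := (k%:R : R).
Hypotheses (k_ge3 : (3 <= k)%N) (mK : involutive m).
Hypothesis mA : forall i, i \in A -> m i \in A.
Local Notation Om := (mates_differ 'I_k m A).
Hypothesis Om_gt0 : (0 < #|Om|)%N.
Let I_ge3 : (3 <= #|'I_k|)%N. Proof. by rewrite card_ord. Qed.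
Let q_gt0 : 0 < q. Proof. by rewrite ltr0n (leq_trans _ k_ge3). Qed.

Lemma mean_ord (f : 'I_k -> R) : mean [set: 'I_k] f = (\sum_c f c) / q.
Proof. by rewrite /mean cardsT card_ord; congr (_ / _); apply: eq_bigl => c; rewrite inE. Qed.

Lemma mean_le_average N (F : X -> R) v : v \in A -> depends_on N F ->
  (m v \in N -> m v != v -> forall x, F x <= F (recolor x v (x (m v)))) ->
  mean Om F <= mean Om (average v F).
Proof.
move=> vA dF Fle; rewrite ler_wpM2r ?invr_ge0//.
have [mvN|mvN] := boolP (m v \in N); last first.
  by rewrite (sum_average I_ge3 mK vA dF)// mvN orbT.
have [mv|mv] := eqVneq (m v) v.
  by rewrite (sum_average I_ge3 mK vA dF)// mv eqxx.
by apply: (sum_average_le I_ge3 mK mA vA); exact: Fle.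
Qed.

(** [free3] depends on a set of colours and grows when two of them are merged. So the three vertices
    can be averaged in turn even if some are mates, and independent colours give [sum_free3]. *)
Lemma mean_free3 i1 i2 i3 : i1 \in A -> i2 \in A -> i3 \in A ->
  i1 != i2 -> i1 != i3 -> i2 != i3 ->
  mean Om (fun x => ((free3 (x i1) (x i2) (x i3))%:R / q) ^+ 3) <= chrom_K33 q / q ^+ 6.
Proof.
move=> iA1 iA2 iA3 n12 n13 n23.
pose h (a b c : 'I_k) : R := ((free3 a b c)%:R / q) ^+ 3.
have h_le (a b c a' b' c' : 'I_k) : [set a'; b'; c'] \subset [set a; b; c] ->
    h a b c <= h a' b' c'.
  move=> sub; rewrite lerXn2r ?nnegrE ?divr_ge0//.
  by rewrite ler_wpM2r ?invr_ge0// ler_nat free3_le.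
pose F1 (x : X) := mean [set: 'I_k] (fun a => h a (x i2) (x i3)).
pose F2 (x : X) := mean [set: 'I_k] (fun b => mean [set: 'I_k] (fun a => h a b (x i3))).
pose F3 := mean [set: 'I_k] (fun c => mean [set: 'I_k] (fun b => mean [set: 'I_k] (fun a => h a b c))).
apply: (@le_trans _ _ (mean Om F1)).
  apply: le_trans (@mean_le_average [set i1; i2; i3] _ i1 iA1 _ _) _.
  - by move=> x y xy; rewrite !xy// !inE eqxx ?orbT.
  - move=> + mi x; rewrite !inE (negPf mi)/= !ffunE eqxx ![_ == i1]eq_sym (negPf n12) (negPf n13).
    move=> mN; apply: h_le; apply/subsetP => z; rewrite !inE.
    by case/orP: mN => /eqP ->; case/orP => [/orP[]|] ->; rewrite ?orbT.
  apply: le_mean => x _; apply: le_mean => c _.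
  by rewrite !ffunE eqxx ![_ == i1]eq_sym (negPf n12) (negPf n13).
apply: (@le_trans _ _ (mean Om F2)).
  apply: le_trans (@mean_le_average [set i2; i3] _ i2 iA2 _ _) _.
  - by move=> x y xy; rewrite /F1 !xy// !inE eqxx ?orbT.
  - move=> + mi x; rewrite !inE (negPf mi)/= => /eqP ->.
    rewrite /F1 !ffunE eqxx ![_ == i2]eq_sym (negPf n23).
    apply: le_mean => a _; apply: h_le; apply/subsetP => z; rewrite !inE.
    by case/orP => [/orP[]|] ->; rewrite ?orbT.
  apply: le_mean => x _; apply: le_mean => c _.
  by rewrite /F1 !ffunE eqxx ![_ == i2]eq_sym (negPf n23).
apply: (@le_trans _ _ (mean Om (fun=> F3))).
  apply: le_trans (@mean_le_average [set i3] _ i3 iA3 _ _) _.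
  - by move=> x y xy; rewrite /F2 !xy// !inE.
  - by move=> + mi x; rewrite !inE (negPf mi).
  by apply: le_mean => x _; apply: le_mean => c _; rewrite /F2 !ffunE eqxx.
rewrite mean_const//.
have -> : F3 = (\sum_(c : 'I_k) \sum_b \sum_a (free3 a b c)%:R ^+ 3) / q ^+ 6.
  rewrite /F3 mean_ord !mulr_suml; apply: eq_bigr => c _.
  rewrite mean_ord !mulr_suml; apply: eq_bigr => b _.
  rewrite mean_ord !mulr_suml; apply: eq_bigr => a _.
  by rewrite /h; field; rewrite gt_eqF.
have := @sum_free3 R 'I_k; rewrite card_ord => <-.
rewrite exchange_big/=; under [X in X / _]eq_bigr do rewrite exchange_big/=.
by rewrite exchange_big/=; under [X in X / _]eq_bigr do rewrite exchange_big/=.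
Qed.

(** The secant bound is affine in the indicators of [x i2 = x i1] and [x i4 = x i1], so only their
    means matter, and each is at most [1/q]. *)
Lemma mean_free22_shared i1 i2 i4 : i1 \in A -> i2 \in A -> i4 \in A ->
  i2 != i1 -> i4 != i1 ->
  mean Om (fun x => ((free22 (x i1) (x i2) (x i1) (x i4))%:R / q ^+ 2) ^+ 3)
  <= shared_bound q / q ^+ 7.
Proof.
move=> iA1 iA2 iA4 n21 n41.
set al := ((q - 2) ^+ 2 - (q - 3)) ^+ 3; set be := ((q - 1) * (q - 2)) ^+ 3.
have q3 : 3 <= q by rewrite ler_nat.
have albe : al <= be.
  by rewrite /al /be lerXn2r ?nnegrE; nra.
pose e v (x : X) : R := (x v == x i1)%:R.
have eE v : v \in A -> v != i1 -> mean Om (e v) <= q^-1.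
  move=> vA v1.
  apply: le_trans (@mean_le_average [set v; i1] (e v) v vA _ _) _.
  - by move=> x y xy; rewrite /e !xy// !inE eqxx ?orbT.
  - move=> + mi x; rewrite !inE (negPf mi)/= => /eqP ->.
    by rewrite /e !ffunE eqxx [i1 == v]eq_sym (negPf v1) eqxx ler_nat; case: (_ == _).
  rewrite -[leRHS](mean_const (D := Om))//; apply: le_mean => x _.
  rewrite /average mean_ord ler_pdivrMr// mulVf ?gt_eqF//.
  rewrite (bigD1 (x i1))//= big1 ?addr0.
    by rewrite /e !ffunE eqxx [i1 == v]eq_sym (negPf v1) eqxx.
  by move=> c cx; rewrite /e !ffunE eqxx [i1 == v]eq_sym (negPf v1) (negPf cx).
apply: (@le_trans _ _ (mean Om (fun x => (al + (be - al) * ((e i2 x + e i4 x) / 2)) / q ^+ 6))).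
  apply: le_mean => x _; rewrite exprMn exprVn -exprM ler_wpM2r ?invr_ge0 ?exprn_ge0//.
  rewrite /al /be -[k in k%:R - 2](card_ord k).
  by have := @free22_shared_le R 'I_k I_ge3 (x i1) (x i2) (x i4); rewrite card_ord.
have -> : mean Om (fun x => (al + (be - al) * ((e i2 x + e i4 x) / 2)) / q ^+ 6) =
    (al + (be - al) * ((mean Om (e i2) + mean Om (e i4)) / 2)) / q ^+ 6.
  rewrite meanMr; congr (_ / _).
  by rewrite meanD mean_const// meanMl meanMr meanD.
have := eE _ iA2 n21; have := eE _ iA4 n41.
set u := mean _ _; set v := mean _ _ => uq vq.
have -> : shared_bound q / q ^+ 7 = (al + (be - al) * (q^-1)) / q ^+ 6.
  by rewrite /shared_bound -/al -/be; field; rewrite gt_eqF.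
rewrite ler_wpM2r ?invr_ge0 ?exprn_ge0// lerD2l ler_wpM2l ?subr_ge0//.
by rewrite ler_pdivrMr//; lra.
Qed.

(** Merging the colour of [i2] with that of [i1], or of [i4] with that of [i3], does not decrease
    [free22]; merging across the two pairs may. The conditions on mates exclude the latter, so [i2]
    and [i4] can be averaged. *)
Lemma mean_free22 i1 i2 i3 i4 : i1 \in A -> i2 \in A -> i3 \in A -> i4 \in A ->
  uniq [:: i1; i2; i3; i4] -> m i2 \notin [set i3; i4] -> m i4 \notin [set i1; i2] ->
  mean Om (fun x => ((free22 (x i1) (x i2) (x i3) (x i4))%:R / q ^+ 2) ^+ 3)
  <= Num.max (path_bound q / q ^+ 8) (shared_bound q / q ^+ 7).
Proof.
move=> iA1 iA2 iA3 iA4; rewrite /= !inE !negb_or.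
move=> /and4P[/and3P[n12 n13 n14] /andP[n23 n24] n34 _] /andP[m23 m24] /andP[m41 m42].
pose h (a b c d : 'I_k) : R := ((free22 a b c d)%:R / q ^+ 2) ^+ 3.
have h_le (a b c d a' b' c' d' : 'I_k) : (free22 a b c d <= free22 a' b' c' d')%N ->
    h a b c d <= h a' b' c' d'.
  move=> le; rewrite lerXn2r ?nnegrE ?divr_ge0 ?exprn_ge0//.
  by rewrite ler_wpM2r ?invr_ge0 ?exprn_ge0// ler_nat.
pose F1 (x : X) := mean [set: 'I_k] (fun b => h (x i1) b (x i3) (x i4)).
pose F2 (a c : 'I_k) := mean [set: 'I_k] (fun d => mean [set: 'I_k] (fun b => h a b c d)).
apply: (@le_trans _ _ (mean Om F1)).
  apply: le_trans (@mean_le_average [set i1; i2; i3; i4] _ i2 iA2 _ _) _.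
  - by move=> x y xy; rewrite !xy// !inE eqxx ?orbT.
  - move=> + mi x; rewrite !inE (negPf m23) (negPf m24) (negPf mi) !orbF => /eqP ->.
    rewrite !ffunE eqxx (negPf n12) [i3 == _]eq_sym (negPf n23) [i4 == _]eq_sym (negPf n24).
    by apply: h_le; exact: free22_eq_le.
  apply: le_mean => x _; apply: le_mean => c _.
  by rewrite !ffunE eqxx (negPf n12) [i3 == _]eq_sym (negPf n23) [i4 == _]eq_sym (negPf n24).
apply: (@le_trans _ _ (mean Om (fun x => F2 (x i1) (x i3)))).
  apply: le_trans (@mean_le_average [set i1; i3; i4] _ i4 iA4 _ _) _.
  - by move=> x y xy; rewrite /F1 !xy// !inE eqxx ?orbT.
  - move=> + mi x; rewrite !inE (negPf m41) (negPf mi) orbF /= => /eqP ->.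
    rewrite /F1 !ffunE eqxx (negPf n14) (negPf n34).
    apply: le_mean => b _; apply: h_le.
    by rewrite free22_swap [leqRHS]free22_swap; exact: free22_eq_le.
  apply: le_mean => x _; apply: le_mean => c _.
  by rewrite /F1 !ffunE eqxx (negPf n14) (negPf n34).
rewrite -[leRHS](mean_const Om_gt0); apply: le_mean => x _.
have F2E a c : F2 a c = (\sum_b \sum_d (free22 a b c d)%:R ^+ 3) / q ^+ 8.
  rewrite /F2 mean_ord exchange_big/= !mulr_suml; apply: eq_bigr => d _.
  rewrite mean_ord !mulr_suml; apply: eq_bigr => b _.
  by rewrite /h; field; rewrite gt_eqF.
(* The joint law of the colours of [i1] and [i3] is left unknown: equal colours give the shared
   bound, distinct ones the path bound. *)
rewrite F2E le_max; have [->|ac] := eqVneq (x i1) (x i3); apply/orP; [right|left]; last first.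
  rewrite ler_wpM2r ?invr_ge0 ?exprn_ge0//.
  by have := @sum_free22_le R 'I_k I_ge3 _ _ ac; rewrite card_ord.
set al := ((q - 2) ^+ 2 - (q - 3)) ^+ 3; set be := ((q - 1) * (q - 2)) ^+ 3.
move: (x i3) => a.
have -> : shared_bound q / q ^+ 7 =
    (\sum_(b < k) \sum_(d < k) (al + (be - al) * (((b == a)%:R + (d == a)%:R) / 2))) / q ^+ 8.
  have E1 (f : bool -> R) : \sum_(c < k) f (c == a) = f true + (q - 1) * f false.
    by rewrite sum_eq1 card_ord.
  pose g (e e' : bool) : R := al + (be - al) * ((e%:R + e'%:R) / 2).
  under eq_bigr => b _ do rewrite (E1 (g (b == a))).
  rewrite (E1 (fun e => g e true + (q - 1) * g e false)) /g /shared_bound -/al -/be /=.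
  by field; rewrite gt_eqF.
rewrite ler_wpM2r ?invr_ge0 ?exprn_ge0//; apply: ler_sum => b _; apply: ler_sum => d _.
by have := @free22_shared_le R 'I_k I_ge3 a b d; rewrite card_ord.
Qed.

End BlockMoments.

(** * Charging every edge of the graph to one factor *)

Section CutCounting.
Variables (G : sgraph) (A : {set G}).
Hypotheses (G_cubic : regular 3 G) (mono_le1 : forall v, (mono_degree A v <= 1)%N).
Local Notation m := (mate A).
Local Notation mK := (mateK mono_le1).

Lemma card_side (S : {set G}) : (forall i, i \in S -> m i \in S) ->
  #|S| = (#|singles A S| + 2 * #|pairs A S|)%N.
Proof.
move=> mS; have m_inj : injective m := inv_inj mK.
have pm : #|[set i in S | (enum_rank (m i) < enum_rank i)%N]| = #|pairs A S|.
  rewrite -(card_imset _ m_inj); apply: eq_card => i; rewrite inE.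
  apply/imsetP/andP => [[j + ->]|[iS r]].
    by rewrite inE mK => /andP[jS r]; split=> //; exact: mS.
  by exists (m i); rewrite ?mK// inE mK r mS.
pose r := [set i | (enum_rank i < enum_rank (m i))%N]; pose f := [set i | m i == i].
have E0 : S :&: f = singles A S by apply/setP => i; rewrite !inE.
have E1 : (S :\: f) :&: r = pairs A S.
  apply/setP => i; rewrite !inE.
  by have [->|_] := eqVneq (m i) i; rewrite ?ltnn ?andbF.
have E2 : (S :\: f) :\: r = [set i in S | (enum_rank (m i) < enum_rank i)%N].
  apply/setP => i; rewrite !inE; have [->|mi] := eqVneq (m i) i; first by rewrite ltnn !andbF.
  rewrite andbC -leqNgt leq_eqVlt /=; congr (_ && _).
  by rewrite [_ == _](inj_eq val_inj) (inj_eq enum_rank_inj) (negPf mi).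
rewrite -(cardsID f S) E0 -(cardsID r (S :\: f)) E1 E2 pm; lia.
Qed.

Lemma card_cross_side (S : {set G}) : (forall i, i \in S -> m i \in S) ->
  (\sum_(i in S) #|[set w | edge i w && (w != m i)]| =
   3 * #|singles A S| + 4 * #|pairs A S|)%N.
Proof.
move=> mS; under eq_bigr do rewrite (card_cross mono_le1 (G_cubic _)).
rewrite (bigID (fun i => m i == i))/=.
under eq_bigr => i /andP[_ ->] do [].
under [X in (_ + X)%N]eq_bigr => i /andP[_ /negPf ->] do [].
have E := card_side mS.
rewrite (eq_bigl (mem (singles A S))) => [|i]; last by rewrite !inE.
rewrite [X in (_ + X)%N](eq_bigl (mem (S :\: singles A S))) => [|i]; last first.
  by rewrite !inE; case: (i \in S); rewrite //= andbT.
rewrite !sum_nat_const cardsD (setIidPr _); first by rewrite E; lia.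
by apply/subsetP => i; rewrite inE => /andP[].
Qed.

(** The bracket is the number of edges: one for a pair in [A], three at an unmatched vertex outside
    [A], and one plus four at a pair there. It is derived by counting the edges across the cut from
    both sides. *)
Lemma cut_edge_count :
  (2 * (#|pairs A A| + (3 * #|singles A (~: A)| + 5 * #|pairs A (~: A)|)) = 3 * #|G|)%N.
Proof.
have mA i : i \in A -> m i \in A by rewrite (mate_side mono_le1).
have mB i : i \in ~: A -> m i \in ~: A by rewrite !inE (mate_side mono_le1).
have : (\sum_(i in A) #|[set w | edge i w && (w != m i)]| =
        \sum_(j in ~: A) #|[set w | edge j w && (w != m j)]|)%N.
  transitivity (\sum_(i in A) \sum_(j in ~: A) edge i j)%N.
    apply: eq_bigr => i iA; rewrite -sum1dep_card big_mkcond [RHS]big_mkcond/=.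
    apply: eq_bigr => j _; rewrite inE; have [e|//] := boolP (edge i j); last by rewrite if_same.
    have [->|jm] := eqVneq j (m i); first by rewrite mA.
    by rewrite (edge_cross mono_le1 e jm) iA.
  rewrite exchange_big/=; apply: eq_bigr => j; rewrite inE => jA.
  rewrite -sum1dep_card big_mkcond [RHS]big_mkcond/=.
  apply: eq_bigr => i _; rewrite edge_sym; have [e|//] := boolP (edge j i); last by rewrite if_same.
  have [->|jm] := eqVneq i (m j); first by rewrite (mate_side mono_le1) (negPf jA).
  by rewrite (edge_cross mono_le1 e jm) jA.
rewrite !card_cross_side//.
by have := card_side mA; have := card_side mB; have := cardsC A; lia.
Qed.

End CutCounting.

Section CutBound.
Variables (R : realType) (G : sgraph) (A : {set G}) (k : nat).
Local Notation X := {ffun G -> 'I_k}.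
Hypotheses (k_ge3 : (3 <= k)%N) (G_cubic : regular 3 G) (A_good : good_cut A).
Local Notation q := (k%:R : R).
Let mono_le1 v : (mono_degree A v <= 1)%N. Proof. exact: (proj1 A_good). Qed.
Let I_ge3 : (3 <= #|'I_k|)%N. Proof. by rewrite card_ord. Qed.
Local Notation m := (mate A).
Local Notation mK := (mateK mono_le1).

Lemma density_single j : j \in reps A -> m j == j ->
  exists i1 i2 i3, [/\ [set u | edge j u] = [set i1; i2; i3],
    [/\ i1 \in A, i2 \in A & i3 \in A], [/\ i1 != i2, i1 != i3 & i2 != i3] &
    forall x : X, block_density R A j x = (free3 (x i1) (x i2) (x i3))%:R / q].
Proof.
move=> jr mj; have [i1 [i2 [i3 [n12 n13 n23 NE]]]] := cards3P (G_cubic j).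
have jA : j \notin A by move: jr; rewrite inE => /andP[].
have ei u : edge j u = (u \in [set i1; i2; i3]) by rewrite -NE inE.
have inA u : u \in [set i1; i2; i3] -> u \in A.
  rewrite -ei => e; rewrite (edge_cross mono_le1 e)//.
  by rewrite (eqP mj); apply: contraTneq e => ->; rewrite edge_irrefl.
exists i1, i2, i3; split=> //; first by split; apply: inA; rewrite !inE eqxx ?orbT.
move=> x; rewrite /block_density /block_palette mj /resample (eqP mj).
pose g (c : 'I_k) : R := (c \notin [set x i1; x i2; x i3])%:R.
rewrite (@eq_mean _ _ _ _ (fun p => g p.1)) => [|p pD].
  rewrite mean_block_fst// mean_ord; congr (_ / _).
  rewrite /g /free3 -sum1_card natr_sum [RHS]big_mkcond/=; apply: eq_bigr => c _.
  by rewrite in_setC; case: (_ \in _).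
congr (nat_of_bool _)%:R; apply/forallP/idP => [h|h u].
  have hu u : edge j u -> p.1 != x u.
    move=> e; have /andP[/implyP/(_ e) + _] := h u; rewrite !ffunE eqxx.
    by have -> : u == j = false by apply: contraTF e => /eqP ->; rewrite edge_irrefl.
  by rewrite !inE !negb_or !hu// ei !inE eqxx ?orbT.
rewrite (eqP mj) andbb; apply/implyP => e; rewrite !ffunE eqxx.
have -> : u == j = false by apply: contraTF e => /eqP ->; rewrite edge_irrefl.
move: e h; rewrite ei !inE !negb_or => + /andP[/andP[h1 h2] h3].
by case/orP => [/orP[]|] /eqP ->.
Qed.

Lemma density_pair j : j \in reps A -> m j != j ->
  exists i1 i2 i3 i4, [/\ [set u | edge j u && (u != m j)] = [set i1; i2],
    [set u | edge (m j) u && (u != j)] = [set i3; i4], i1 != i2, i3 != i4 &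
    [/\ i1 \in A, i2 \in A, i3 \in A & i4 \in A] /\
    forall x : X, block_density R A j x =
      (free22 (x i1) (x i2) (x i3) (x i4))%:R / q ^+ 2].
Proof.
move=> jr mj.
have jA : j \notin A by move: jr; rewrite inE => /andP[].
have := card_cross mono_le1 (G_cubic j); rewrite (negPf mj) => /eqP/cards2P[i1 [i2 [n12 N1]]].
have := card_cross mono_le1 (G_cubic (m j)); rewrite mK eq_sym (negPf mj).
move=> /eqP/cards2P[i3 [i4 [n34 N2]]].
have e1 u : edge j u && (u != m j) = (u \in [set i1; i2]) by rewrite -N1 inE.
have e2 u : edge (m j) u && (u != j) = (u \in [set i3; i4]) by rewrite -N2 inE.
have inA1 u : u \in [set i1; i2] -> u \in A.
  by rewrite -e1 => /andP[e nu]; rewrite (edge_cross mono_le1 e nu).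
have inA2 u : u \in [set i3; i4] -> u \in A.
  by rewrite -e2 => /andP[e nu]; rewrite (edge_cross mono_le1 e) ?mK// (mate_side mono_le1).
exists i1, i2, i3, i4; split=> //; split.
  by split; [apply: inA1|apply: inA1|apply: inA2|apply: inA2]; rewrite !inE eqxx ?orbT.
move=> x; rewrite /block_density /block_palette (negPf mj) /resample /mean.
rewrite cardsT card_prod card_ord natrM expr2; congr (_ / _).
rewrite /free22 -sum1_card natr_sum [RHS]big_mkcond/= [LHS]big_mkcond; apply: eq_bigr => p _.
rewrite in_setT inE.
suff -> : block_ok A j (recolor2 x j (m j) p) =
    [&& p.1 != p.2, p.1 \notin [set x i1; x i2] & p.2 \notin [set x i3; x i4]].
  by case: [&& _, _ & _].
have emj : edge j (m j) by exact: edge_mate.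
have nA u v : u \in A -> v \notin A -> u == v = false.
  by move=> uA vA; apply: contraNF vA => /eqP <-.
have mjA : m j \notin A by rewrite (mate_side mono_le1).
apply/forallP/and3P => [h|[h1 h2 h3] u].
  have /andP[/implyP/(_ emj) + _] := h (m j); rewrite !ffunE !eqxx (negPf mj) => p12.
  have h1 u : u \in [set i1; i2] -> p.1 != x u.
    move=> ui; have uA := inA1 u ui; move: ui; rewrite -e1 => /andP[e _].
    by have /andP[/implyP/(_ e) + _] := h u; rewrite !ffunE eqxx !nA.
  have h2 u : u \in [set i3; i4] -> p.2 != x u.
    move=> ui; have uA := inA2 u ui; move: ui; rewrite -e2 => /andP[e _].
    by have /andP[_ /implyP/(_ e)] := h u; rewrite !ffunE eqxx (negPf mj) !nA.
  by split=> //; rewrite !inE negb_or ?h1 ?h2// !inE eqxx ?orbT.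
apply/andP; split; apply/implyP => e.
  have [->|um] := eqVneq u (m j); first by rewrite !ffunE !eqxx (negPf mj).
  have ui : u \in [set i1; i2] by rewrite -e1 e.
  rewrite !ffunE eqxx !nA ?(inA1 _ ui)//.
  by move: ui h2; rewrite !inE negb_or => /orP[] /eqP -> /andP[].
have [->|um] := eqVneq u j; first by rewrite !ffunE !eqxx (negPf mj) eq_sym.
have ui : u \in [set i3; i4] by rewrite -e2 e.
rewrite !ffunE eqxx (negPf mj) !nA ?(inA2 _ ui)//.
by move: ui h3; rewrite !inE negb_or => /orP[] /eqP -> /andP[].
Qed.

End CutBound.

Section EdgeDensity.
Variables (R : realType) (k : nat).
Hypothesis k_ge3 : (3 <= k)%N.
Local Notation q := (k%:R : R).
Let q3 : 3 <= q. Proof. by rewrite ler_nat. Qed.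
Let q_gt0 : 0 < q. Proof. by rewrite ltr0n (leq_trans _ k_ge3). Qed.

Lemma chrom_K33_gt0 : 0 < chrom_K33 q.
Proof.
have := edge_density_lt q3; rewrite -(@pmulr_lgt0 _ (q ^+ 3)) ?exprn_gt0//.
by apply: le_lt_trans; rewrite exprn_ge0// subr_ge0 ler1n (leq_trans _ k_ge3).
Qed.

(* The contribution of one edge: [edge_density ^+ 9] is the probability that a
   random colouring of [K_{3,3}] is proper. *)
Definition edge_density : R := (chrom_K33 q / q ^+ 6) `^ 9^-1.
Local Notation theta := edge_density.

Lemma edge_densityX : theta ^+ 9 = chrom_K33 q / q ^+ 6.
Proof.
have p0 : 0 <= chrom_K33 q / q ^+ 6 by rewrite divr_ge0 ?exprn_ge0 ?ltW// chrom_K33_gt0.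
by rewrite -powR_mulrn ?powR_ge0// -powRrM mulVf ?powRr1 ?pnatr_eq0.
Qed.

Lemma edge_density_chrom e n : (2 * e = 3 * n)%N ->
  (q ^+ n * theta ^+ e) ^+ 6 = chrom_K33 q ^+ n.
Proof.
move=> en; have eE : (e * 6 = 9 * n)%N by lia.
rewrite exprMn -!exprM eE mulnC !exprM -exprMn edge_densityX.
by rewrite mulrC divfK// gt_eqF// exprn_gt0.
Qed.

Lemma edge_density_gt0 : 0 < theta.
Proof. by rewrite powR_gt0// divr_gt0 ?exprn_gt0// chrom_K33_gt0. Qed.

Lemma edge_density_gt : 1 - q^-1 < theta.
Proof.
have r0 : 0 <= 1 - q^-1 by rewrite subr_ge0 invf_le1// ler1n (leq_trans _ k_ge3).
rewrite -(@ltr_pXn2r _ 9)// ?nnegrE ?ltW ?edge_density_gt0// edge_densityX.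
rewrite ltr_pdivlMr ?exprn_gt0//.
have -> : (1 - q^-1) ^+ 9 * q ^+ 6 = (q - 1) ^+ 9 / q ^+ 3 by field; rewrite gt_eqF.
by rewrite ltr_pdivrMr ?exprn_gt0//; exact: edge_density_lt.
Qed.

Lemma cbrt_le_theta (x : R) n : 0 <= x -> x <= theta ^+ (3 * n) -> cbrt x <= theta ^+ n.
Proof.
move=> x0 xn; rewrite -(@ler_pXn2r _ 3)// ?nnegrE ?cbrt_ge0 ?exprn_ge0 ?(ltW edge_density_gt0)//.
by rewrite cbrtK// -exprM [(n * 3)%N]mulnC.
Qed.

(** Cubing produces [theta ^ 45], which is the fifth power of [chrom_K33 q / q ^ 6]; both claims
    become polynomial inequalities in [q]. *)
Lemma pair_moment_le :
  Num.max (path_bound q / q ^+ 8) (shared_bound q / q ^+ 7) <= theta ^+ 15.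
Proof.
have th0 : 0 <= theta ^+ 15 by rewrite exprn_ge0// ltW// edge_density_gt0.
have th45 : (theta ^+ 15) ^+ 3 = chrom_K33 q ^+ 5 / q ^+ 30.
  by rewrite -exprM (exprM _ 9 5) edge_densityX exprMn exprVn -exprM.
have q0 n : 0 < q ^+ n by rewrite exprn_gt0.
have pb0 := path_bound_ge0 q3; have sb0 := shared_bound_ge0 q3.
rewrite ge_max; apply/andP; split.
  rewrite -(@ler_pXn2r _ 3)// ?nnegrE ?divr_ge0 ?(ltW (q0 _))// th45 exprMn exprVn -exprM.
  rewrite ler_pdivrMr// mulrAC ler_pdivlMr//.
  have := path_bound_le q3; rewrite -(ler_pM2r (q0 24)) => H.
  by rewrite -[leLHS](_ : path_bound q ^+ 3 * q ^+ 6 * q ^+ 24 = _)// -mulrA -exprD.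
rewrite -(@ler_pXn2r _ 3)// ?nnegrE ?divr_ge0 ?(ltW (q0 _))// th45 exprMn exprVn -exprM.
rewrite ler_pdivrMr// mulrAC ler_pdivlMr//.
have := shared_bound_le q3; rewrite -(ler_pM2r (q0 21)) => H.
by rewrite -[leLHS](_ : shared_bound q ^+ 3 * q ^+ 9 * q ^+ 21 = _)// -mulrA -exprD.
Qed.

End EdgeDensity.

Section CutBound.
Variables (R : realType) (G : sgraph) (A : {set G}) (k : nat).
Local Notation X := {ffun G -> 'I_k}.
Hypotheses (k_ge3 : (3 <= k)%N) (G_cubic : regular 3 G) (A_good : good_cut A).
Local Notation q := (k%:R : R).
Let mono_le1 v : (mono_degree A v <= 1)%N. Proof. exact: (proj1 A_good). Qed.
Let q_gt0 : 0 < q. Proof. by rewrite ltr0n (leq_trans _ k_ge3). Qed.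
Local Notation m := (mate A).
Local Notation mK := (mateK mono_le1).
Local Notation Om := (mates_differ 'I_k m A).
Local Notation theta := (edge_density R k).
Local Notation moment j := (mean Om (fun x => block_density R A j x ^+ 3)).
Let mA i : i \in A -> m i \in A. Proof. by rewrite (mate_side mono_le1). Qed.
Let Om0 : (0 < #|Om|)%N. Proof. exact: Om_gt0. Qed.

Let moment_ge0 j : 0 <= moment j.
Proof. by apply: mean_ge0 => x; rewrite exprn_ge0// block_density_ge0. Qed.

Lemma cbrt_moment_single j : j \in reps A -> m j == j -> cbrt (moment j) <= theta ^+ 3.
Proof.
move=> jr mj; have [i1 [i2 [i3 [_ [iA1 iA2 iA3] [n12 n13 n23] E]]]] :=
  density_single R k_ge3 G_cubic A_good jr mj.
apply: cbrt_le_theta => //; rewrite edge_densityX//.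
under eq_mean => x _ do rewrite E.
exact: (@mean_free3 R G k m A k_ge3 mK mA Om0).
Qed.

(** If [i] and [i'] both had mates, but not each other, the second clause of [good_cut] would make
    them adjacent. They lie on the same side, so they would be mates after all. *)
Lemma mated_neighbours_adjacent j i i' : edge j i -> edge j i' ->
  i != m j -> i' != m j -> i != i' -> m j != j ->
  (m i' == i') || (m i' == i) || (m i == i).
Proof.
move=> e e' n n' ii' mj; apply: contraT; rewrite !negb_or => /andP[/andP[mi' mi'i] mi].
have deg1 v : m v != v -> mono_degree A v = 1 by case: (mateP mono_le1 v) => [w|]; rewrite ?eqxx.
have nm w : edge j w -> w != m j -> ~~ mono_edge A j w.
  by move=> _; apply: contraNN => /(mate_mono_edge mono_le1) ->.
have := proj2 A_good j i i' ii' e e' (nm _ e n) (nm _ e' n') (deg1 _ mj) (deg1 _ mi) (deg1 _ mi').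
move=> eii'; case/eqP: mi'i; apply: (mate_mono_edge mono_le1); rewrite /mono_edge edge_sym eii'.
by rewrite (edge_cross mono_le1 e n) (edge_cross mono_le1 e' n') eqxx.
Qed.

(** Selects the neighbour that [mean_free22] can average: one that is unmatched or mated to the
    other. *)
Lemma order_neighbours j (i1 i2 : G) : m j != j ->
  [set u | edge j u && (u != m j)] = [set i1; i2] -> i1 != i2 ->
  (m i2 \in [set i1; i2]) || (m i1 \in [set i1; i2]).
Proof.
move=> mj NE n12.
have /andP[e1 n1] : edge j i1 && (i1 != m j) by have := set21 i1 i2; rewrite -NE inE.
have /andP[e2 n2] : edge j i2 && (i2 != m j) by have := set22 i1 i2; rewrite -NE inE.
rewrite !inE; have /orP[/orP[]|] := mated_neighbours_adjacent e1 e2 n1 n2 n12 mj => /eqP ->;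
  by rewrite eqxx ?orbT.
Qed.

Lemma cbrt_moment_pair j : j \in reps A -> m j != j -> cbrt (moment j) <= theta ^+ 5.
Proof.
move=> jr mj; apply: cbrt_le_theta => //.
have [i1 [i2 [i3 [i4 [N1 N2 n12 n34 [[iA1 iA2 iA3 iA4] E]]]]]] :=
  density_pair R k G_cubic A_good jr mj.
apply: le_trans (pair_moment_le R k_ge3).
have swap_le (f g : X -> R) : f =1 g -> mean Om g <= Num.max (path_bound q / q ^+ 8)
    (shared_bound q / q ^+ 7) -> mean Om f <= Num.max (path_bound q / q ^+ 8)
    (shared_bound q / q ^+ 7) by move=> fg; apply: le_trans; apply: le_mean => x _; rewrite fg.
have shared a b d : a \in A -> b \in A -> d \in A -> b != a -> d != a ->
    mean Om (fun x : X => ((free22 (x a) (x b) (x a) (x d))%:R / q ^+ 2) ^+ 3) <=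
    Num.max (path_bound q / q ^+ 8) (shared_bound q / q ^+ 7).
  move=> aA bA dA ba da; rewrite le_max; apply/orP; right.
  exact: (@mean_free22_shared R G k m A k_ge3 mK mA Om0 a b d).
have C2 (a b c d : 'I_k) : free22 a b c d = free22 a b d c.
  by rewrite free22_swap free22C free22_swap.
(* If the ends of the edge have a common neighbour, symmetries of [free22] bring it to the first and
   third positions, and the shared bound applies. *)
have [e13|n13] := eqVneq i1 i3.
  apply: swap_le (shared i1 i2 i4 _ _ _ _ _) => // [x||]; first by rewrite E e13.
    by rewrite eq_sym.
  by rewrite e13 eq_sym.
have [e14|n14] := eqVneq i1 i4.
  apply: swap_le (shared i1 i2 i3 _ _ _ _ _) => // [x||]; first by rewrite E C2 e14.
    by rewrite eq_sym.
  by rewrite e14.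
have [e23|n23] := eqVneq i2 i3.
  apply: swap_le (shared i2 i1 i4 _ _ _ _ _) => // [x|]; first by rewrite E free22C e23.
  by rewrite e23 eq_sym.
have [e24|n24] := eqVneq i2 i4.
  apply: swap_le (shared i2 i1 i3 _ _ _ _ _) => // [x|]; first by rewrite E free22C C2 e24.
  by rewrite e24.
have main a b c d : a \in A -> b \in A -> c \in A -> d \in A ->
    uniq [:: a; b; c; d] -> m b \in [set a; b] -> m d \in [set c; d] ->
    mean Om (fun x : X => ((free22 (x a) (x b) (x c) (x d))%:R / q ^+ 2) ^+ 3) <=
    Num.max (path_bound q / q ^+ 8) (shared_bound q / q ^+ 7).
  move=> aA bA cA dA u mb md.
  apply: (@mean_free22 R G k m A k_ge3 mK mA Om0 a b c d) => //.
    move: u mb; rewrite /= !inE !negb_or => /and4P[/and3P[ab ac ad] /andP[bc bd] cd _].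
    by case/orP => /eqP ->; apply/andP; split.
  move: u md; rewrite /= !inE !negb_or => /and4P[/and3P[ab ac ad] /andP[bc bd] cd _].
  by case/orP => /eqP ->; apply/andP; split; rewrite eq_sym.
have mmj : m (m j) != m j by rewrite mK eq_sym.
have N2' : [set u | edge (m j) u && (u != m (m j))] = [set i3; i4] by rewrite mK.
have u4 : uniq [:: i1; i2; i3; i4] by rewrite /= !inE !negb_or n12 n13 n14 n23 n24 n34.
have u4P := perm_uniq (s1 := [:: i1; i2; i3; i4]).
(* Within each pair, the vertex that can be averaged is moved to the second position. *)
case/orP: (order_neighbours mj N1 n12) => m1; case/orP: (order_neighbours mmj N2' n34) => m2.
- by apply: swap_le (main i1 i2 i3 i4 _ _ _ _ _ _ _) => // x; rewrite E.
- apply: swap_le (main i1 i2 i4 i3 _ _ _ _ _ _ _) => //; first by move=> x; rewrite E C2.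
    by rewrite /= !inE !negb_or n12 n13 n14 n23 n24 eq_sym n34.
  by rewrite setUC.
- apply: swap_le (main i2 i1 i3 i4 _ _ _ _ _ _ _) => //; first by move=> x; rewrite E free22C.
    by rewrite /= !inE !negb_or [_ == i1]eq_sym n12 n13 n14 n23 n24 n34.
  by rewrite setUC.
- apply: swap_le (main i2 i1 i4 i3 _ _ _ _ _ _ _) => //; first by move=> x; rewrite E free22C C2.
  + by rewrite /= !inE !negb_or [_ == i1]eq_sym n12 n13 n14 n23 n24 eq_sym n34.
  + by rewrite setUC.
  + by rewrite setUC.
Qed.

Lemma prod_moments_le :
  \prod_(j in reps A) cbrt (moment j) <=
  theta ^+ (3 * #|singles A (~: A)| + 5 * #|pairs A (~: A)|).
Proof.
rewrite (bigID (fun j => m j == j))/= exprD !exprM.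
have th0 := edge_density_gt0 R k_ge3.
rewrite ler_pM//.
- by rewrite prodr_ge0// => *; rewrite cbrt_ge0.
- by rewrite prodr_ge0// => *; rewrite cbrt_ge0.
- rewrite -prodr_const (eq_bigl (mem (singles A (~: A)))) => [|j]; last first.
    rewrite !inE -andbA; congr (_ && _).
    by have [->|] := eqVneq (m j) j; rewrite ?leqnn ?andbF.
  apply: ler_prod => j; rewrite !inE => /andP[jA mj]; rewrite cbrt_ge0/=.
  by apply: cbrt_moment_single => //; rewrite inE jA (eqP mj) leqnn.
- rewrite -prodr_const (eq_bigl (mem (pairs A (~: A)))) => [|j]; last first.
    rewrite !inE -andbA; congr (_ && _); rewrite [RHS]ltn_neqAle andbC; congr (_ && _).
    by rewrite [_ == _ :> nat](inj_eq val_inj) (inj_eq enum_rank_inj) eq_sym.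
  apply: ler_prod => j; rewrite !inE => /andP[jA mj]; rewrite cbrt_ge0/=.
  apply: cbrt_moment_pair; first by rewrite inE jA ltnW.
  by apply: contraTneq mj => ->; rewrite ltnn.
Qed.

Lemma num_colorings_cut_lt : (0 < #|pairs A A|)%N ->
  (num_colorings k G)%:R ^+ 6 < chrom_K33 q ^+ #|G| :> R.
Proof.
move=> pA; have th0 := edge_density_gt0 R k_ge3; have th1 := edge_density_gt R k_ge3.
have r0 : 0 <= 1 - q^-1 by rewrite subr_ge0 invf_le1// ler1n (leq_trans _ k_ge3).
have cnt := cut_edge_count G_cubic mono_le1.
rewrite -(edge_density_chrom R k_ge3 cnt) ltrXn2r ?nnegrE ?mulr_ge0 ?exprn_ge0 ?(ltW th0) ?(ltW q_gt0)//.
apply: (le_lt_trans (num_colorings_le R k_ge3 G_cubic A_good)).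
rewrite (card_Om R k_ge3 A_good) -mulrA ltr_pM2l ?exprn_gt0//.
rewrite exprD; apply: (@le_lt_trans _ _ ((1 - q^-1) ^+ #|pairs A A| *
    theta ^+ (3 * #|singles A (~: A)| + 5 * #|pairs A (~: A)|))).
  by rewrite ler_wpM2l ?exprn_ge0// prod_moments_le.
by rewrite ltr_pM2r ?exprn_gt0// ltrXn2r ?nnegrE ?(ltW th0)// -lt0n.
Qed.

End CutBound.

(** * The bipartite case *)

Definition bipartition (G : sgraph) (A : {set G}) :=
  forall u v, edge u v -> (u \in A) = (v \notin A).

Section Bipartite.
Variables (R : realType) (G : sgraph) (A : {set G}) (k : nat).
Local Notation X := {ffun G -> 'I_k}.
Hypotheses (k_ge3 : (3 <= k)%N) (G_cubic : regular 3 G) (A_bip : bipartition A).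
Local Notation q := (k%:R : R).
Local Notation m := (mate A).
Local Notation Om := (mates_differ 'I_k m A).
Local Notation theta := (edge_density R k).
Local Notation density := (block_density R A).
Let I_ge3 : (3 <= #|'I_k|)%N. Proof. by rewrite card_ord. Qed.
Let q_gt0 : 0 < q. Proof. by rewrite ltr0n (leq_trans _ k_ge3). Qed.

Lemma mono_edge_bipartition u v : mono_edge A u v = false.
Proof. by apply/andP => -[/A_bip ->]; case: (v \in A). Qed.

Lemma good_cut_bipartition : good_cut A.
Proof.
have d0 v : mono_degree A v = 0 by rewrite /mono_degree big1 // => w _; rewrite mono_edge_bipartition.
by split=> [v|j i i']; rewrite d0.
Qed.

Let A_good := good_cut_bipartition.
Let mono_le1 v : (mono_degree A v <= 1)%N. Proof. exact: (proj1 A_good). Qed.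

Lemma mate_id v : m v = v.
Proof. by case: mateP => // w; rewrite mono_edge_bipartition. Qed.

Let mK : involutive m. Proof. by move=> v; rewrite !mate_id. Qed.
Let mA i : i \in A -> m i \in A. Proof. by rewrite mate_id. Qed.

Lemma density_image j (x : X) : j \notin A ->
  density j x = #|~: (x @: [set u | edge j u])|%:R / q.
Proof.
move=> jA; have jr : j \in reps A by rewrite inE jA mate_id leqnn.
have mj : m j == j by rewrite mate_id.
have [i1 [i2 [i3 [-> _ _ ->]]]] := density_single R k_ge3 G_cubic A_good jr mj.
by rewrite /free3 !imsetU !imset_set1.
Qed.

Lemma average_prod_le (S : {set G}) (N : G -> {set G}) (F : G -> X -> R) i x :
  i \in A -> (forall j y, 0 <= F j y) -> (forall j, depends_on (N j) (F j)) ->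
  (#|[set j in S | i \in N j]| <= 3)%N ->
  average i (fun y => \prod_(j in S) cbrt (F j y)) x <=
  \prod_(j in S) cbrt (average i (F j) x).
Proof.
move=> iA F0 dF Ni; apply: (@mean_hoelder_set _ _ _ _ _ S [set j in S | i \in N j]) => //.
  by rewrite cardsT (leq_trans _ I_ge3).
move=> j jS; rewrite inE jS /= => iN c c' _ _; apply: dF => v vN; rewrite !ffunE.
by have [vi|//] := eqVneq v i; rewrite -vi vN in iN.
Qed.

Lemma average_prod_lt i j1 j2 i' : i \in A -> edge i j1 -> edge i j2 ->
  edge j1 i' -> ~~ edge j2 i' -> exists x : X,
  average i (fun y => \prod_(j in reps A) cbrt (density j y ^+ 3)) x <
  \prod_(j in reps A) cbrt (average i (fun y => density j y ^+ 3) x).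
Proof.
move=> iA e1 e2 e1' e2'.
pose F j (x : X) := density j x ^+ 3.
pose c0 : 'I_k := Ordinal (ltn_trans (isT : 0 < 2)%N k_ge3).
pose c1 : 'I_k := Ordinal (ltn_trans (isT : 1 < 2)%N k_ge3).
(* Away from [i] only [c0] and [c1] occur, the latter at [i'] alone. The vertex [j1] sees both
   colours whether [i] has [c0] or [c1], while [j2] sees [c1] only if [i] has it; so their densities
   are not proportional as functions of the colour of [i]. Two colours leave all densities positive,
   as [q >= 3]. *)
pose x0 : X := [ffun v => if v == i' then c1 else c0]; exists x0.
have i'i : i' != i by apply: contraNneq e2' => ->; rewrite edge_sym.
pose d j c := density j (recolor x0 i c).
have d0 j c : 0 <= d j c by exact: block_density_ge0.
have nA j u : u \in A -> edge j u -> j \notin A by move=> uA /A_bip ->; rewrite uA.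
have [jA1 jA2] : j1 \notin A /\ j2 \notin A.
  by split; apply: (nA _ i) => //; rewrite edge_sym.
have j12 : j1 != j2 by apply: contraNneq e2' => <-.
have [j3 Ni] : exists j3, [set u | edge i u] :\ j1 :\ j2 = [set j3].
  apply/cards1P; have := G_cubic i; rewrite /degree (cardsD1 j1) inE e1 => -[].
  by rewrite add0n [#|_ :\ j1|](cardsD1 j2) !inE [j2 == j1]eq_sym j12 e2 add1n => -[->].
have /and3P[j32 j31 e3] : [&& j3 != j2, j3 != j1 & edge i j3].
  by have := set11 j3; rewrite -Ni !inE.
have jA3 : j3 \notin A by apply: (nA _ i) => //; rewrite edge_sym.
have in_reps j : (j \in reps A) = (j \notin A) by rewrite inE mate_id leqnn andbT.
pose S := reps A :\ j1 :\ j2 :\ j3.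
have PE (a : G -> R) : \prod_(j in reps A) a j = a j1 * a j2 * a j3 * \prod_(j in S) a j.
  rewrite (big_setD1 j1) ?in_reps//= (big_setD1 j2) ?inE 1?eq_sym ?j12 -?[_ && _]in_reps//=.
    rewrite (big_setD1 j3)//= ?mulrA// !inE j32 j31 jA3/=; by rewrite mate_id leqnn.
  by rewrite jA2 mate_id leqnn.
have dS j c : j \in S -> d j c = d j c0.
  rewrite !inE => /and4P[j_3 j_2 j_1 /andP[jA _]]; rewrite /d.
  have iN : i \notin block_boundary A j.
    rewrite in_boundary ?in_reps// iA mate_id orbb /=; apply/negP => e.
    have : j \in [set j3] by rewrite -Ni !inE j_2 j_1 edge_sym e.
    by rewrite inE (negPf j_3).
  apply: (block_density_dep R) => v vN; rewrite !ffunE.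
  by have [vi|//] := eqVneq v i; rewrite -vi vN in iN.
have x0i c u : recolor x0 i c u = if u == i then c else if u == i' then c1 else c0.
  by rewrite !ffunE.
have dE j c : j \notin A -> d j c = (q - #|recolor x0 i c @: [set u | edge j u]|%:R) / q.
  by move=> jA; rewrite /d density_image// cards_setC card_ord.
have image_le j : (#|recolor x0 i c0 @: [set u | edge j u]| <= 2)%N.
  apply: (@leq_trans #|[set c0; c1]|); last by rewrite cards2.
  apply/subset_leq_card/subsetP => _ /imsetP[u _ ->]; rewrite x0i !inE.
  by do 2?case: ifP => _; rewrite ?eqxx ?orbT.
have d_gt0 j : j \notin A -> 0 < d j c0.
  move=> jA; rewrite dE// divr_gt0// subr_gt0 ltr_nat.
  exact: leq_ltn_trans (image_le j) k_ge3.
have ei1 : edge j1 i by rewrite edge_sym.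
have ei2 : edge j2 i by rewrite edge_sym.
have [w1 ew1 /andP[wi1 wi'1]] : exists2 w, edge j1 w & (w != i) && (w != i').
  have : (0 < #|[set u | edge j1 u] :\ i :\ i'|)%N.
    have := G_cubic j1; rewrite /degree (cardsD1 i) inE ei1 => -[].
    by rewrite add0n [#|_ :\ i|](cardsD1 i') !inE i'i e1' add1n => -[->].
  by case/card_gt0P => w; rewrite !inE => /and3P[w1 w2 w3]; exists w; rewrite ?w1 ?w2.
have [w2 ew2 wi2] : exists2 w, edge j2 w & w != i.
  have : (0 < #|[set u | edge j2 u] :\ i|)%N.
    by have := G_cubic j2; rewrite /degree (cardsD1 i) inE ei2 add1n => -[->].
  by case/card_gt0P => w; rewrite !inE => /andP[? ?]; exists w.
have im1 c : recolor x0 i c @: [set u | edge j1 u] = [set c; c1; c0].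
  apply/setP => e; rewrite !inE; apply/imsetP/idP => [[u _ ->]|].
    by rewrite x0i; do 2?case: ifP => _; rewrite eqxx ?orbT.
  case/orP => [/orP[]|] /eqP ->; [exists i|exists i'|exists w1]; rewrite ?inE// x0i ?eqxx//.
    by rewrite (negPf i'i).
  by rewrite (negPf wi1) (negPf wi'1).
have im2 c : recolor x0 i c @: [set u | edge j2 u] = [set c; c0].
  apply/setP => e; rewrite !inE; apply/imsetP/idP => [[u + ->]|].
    rewrite inE x0i => eu; case: ifP => _; first by rewrite eqxx.
    have -> : u == i' = false by apply: contraTF eu => /eqP ->.
    by rewrite eqxx orbT.
  case/orP => /eqP ->; [exists i|exists w2]; rewrite ?inE// x0i ?eqxx//.
  by rewrite (negPf wi2); case: eqVneq => // w2i'; rewrite -w2i' ew2 in e2'.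
have c10 : c1 != c0 by [].
have d1c0 : d j1 c0 = (q - 2) / q.
  by rewrite dE// im1 setUC setUA setUid setUC cards2 c10.
have d1c1 : d j1 c1 = (q - 2) / q by rewrite dE// im1 setUid cards2 c10.
have d2c0 : d j2 c0 = (q - 1) / q by rewrite dE// im2 setUid cards1.
have d2c1 : d j2 c1 = (q - 2) / q by rewrite dE// im2 cards2 c10.
pose s j := \sum_c d j c ^+ 3.
have s_gt0 j : j \notin A -> 0 < s j.
  move=> jA; rewrite /s (bigD1 c0)//= ltr_wpDr ?exprn_gt0 ?d_gt0// sumr_ge0// => c _.
  by rewrite exprn_ge0.
have [c cP] : exists c, d j1 c ^+ 3 * s j2 != d j2 c ^+ 3 * s j1.
  have q2 : 0 < (q - 2) / q by rewrite divr_gt0// subr_gt0 ltr_nat.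
  (* Proportionality at [c1] would force [s j1 = s j2], and then it fails at [c0]. *)
  have [E1|] := eqVneq (d j1 c1 ^+ 3 * s j2) (d j2 c1 ^+ 3 * s j1); last by exists c1.
  exists c0; rewrite d1c1 d2c1 in E1; rewrite d1c0 d2c0.
  have -> : s j2 = s j1 by apply: mulfI E1; rewrite gt_eqF// exprn_gt0.
  rewrite (inj_eq (mulIf (lt0r_neq0 (s_gt0 _ jA1)))) lt_eqF//.
  have lt : (q - 2) / q < (q - 1) / q by rewrite ltr_pM2r ?invr_gt0// ltrD2l ltrN2 ltr1n.
  by rewrite ltrXn2r ?nnegrE ?(ltW q2)// ltW// (lt_trans q2).
have := @hoelder3_lt R 'I_k predT (d j1) (d j2) (d j3) c (d0 j1) (d0 j2) (d0 j3) isT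
  (s_gt0 _ jA1) (s_gt0 _ jA2) (s_gt0 _ jA3) cP.
rewrite -!/(s _) => H.
pose D := \prod_(j in S) d j c0.
have D_gt0 : 0 < D.
  by apply: prodr_gt0 => j; rewrite !inE => /and4P[_ _ _ /andP[jA _]]; exact: d_gt0.
have avgE j : average i (F j) x0 = s j / q by rewrite /average mean_ord.
have avgS j : j \in S -> cbrt (average i (F j) x0) = d j c0.
  move=> jS; rewrite avgE /s (eq_bigr (fun=> d j c0 ^+ 3)) => [|c' _]; last by rewrite dS.
  rewrite sumr_const card_ord -[X in X / _]mulr_natr mulfK ?gt_eqF// cbrtX//.
have R_E : \prod_(j in reps A) cbrt (average i (F j) x0) =
    cbrt (s j1) * cbrt (s j2) * cbrt (s j3) / q * D.
  rewrite PE !avgE (eq_bigr (fun j => d j c0)) => [|j jS]; last exact: avgS.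
  by rewrite cbrt_div3 ?ltW ?s_gt0.
have L_E : average i (fun y => \prod_(j in reps A) cbrt (F j y)) x0 =
    (\sum_c d j1 c * d j2 c * d j3 c) / q * D.
  rewrite /average mean_ord [RHS]mulrAC; congr (_ / _); rewrite mulr_suml.
  apply: eq_bigr => c' _; rewrite PE /F !cbrtX ?block_density_ge0//; congr (_ * _).
  by apply: eq_bigr => j jS; rewrite cbrtX ?block_density_ge0//; exact: dS.
suff : average i (fun y => \prod_(j in reps A) cbrt (F j y)) x0 <
    \prod_(j in reps A) cbrt (average i (F j) x0) by [].
by rewrite R_E L_E ltr_pM2r// ltr_pM2r ?invr_gt0.
Qed.

(** The vertex [i] is averaged first. Every colouring lies in [Om], so strictness at a single one
    survives in the mean, and [finner] handles the remaining vertices. *)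
Lemma num_colorings_bipartite_lt i j1 j2 i' : i \in A -> edge i j1 -> edge i j2 ->
  edge j1 i' -> ~~ edge j2 i' ->
  (num_colorings k G)%:R ^+ 6 < chrom_K33 q ^+ #|G| :> R.
Proof.
move=> iA e1 e2 e1' e2'.
have Om0 : (0 < #|Om|)%N by exact: Om_gt0.
pose F j (x : X) := density j x ^+ 3.
have F0 j x : 0 <= F j x by rewrite exprn_ge0// block_density_ge0.
have dF j : depends_on (block_boundary A j) (F j).
  by move=> x y xy; rewrite /F (block_density_dep R xy).
have deg v : v \in A -> (#|[set j in reps A | v \in block_boundary A j]| <= 3)%N.
  by move=> vA; have := boundary_degree G_cubic A_good vA; rewrite mate_id eqxx.
have pointwise x := average_prod_le x iA F0 dF (deg i iA).
have [x0 strict] := average_prod_lt iA e1 e2 e1' e2'.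
have meanE (H : X -> R) : mean Om H = mean Om (average i H).
  rewrite /mean (sum_average I_ge3 mK iA (@depends_on_setT _ _ _ H))//.
  by rewrite mate_id eqxx.
have Om_all x : x \in Om.
  by apply/mates_differP => v _; rewrite mate_id eqxx.
have lt1 : mean Om (fun x => \prod_(j in reps A) cbrt (F j x)) <
    mean Om (fun x => \prod_(j in reps A) cbrt (average i (F j) x)).
  rewrite meanE /mean ltr_pM2r ?invr_gt0 ?ltr0n//.
  rewrite (bigD1 x0)//= [ltRHS](bigD1 x0)//= ltr_leD//.
  by apply: ler_sum => x _; exact: pointwise.
have le2 : mean Om (fun x => \prod_(j in reps A) cbrt (average i (F j) x)) <=
    \prod_(j in reps A) cbrt (mean Om (F j)).
  under [X in _ <= X]eq_bigr do rewrite meanE.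
  apply: (@finner R G 'I_k G m A I_ge3 mK mA Om0 (reps A)
    (fun j => block_boundary A j :\ i)).
  - by move=> j x; apply: mean_ge0.
  - by move=> j; apply: depends_on_average.
  - move=> j jr; apply: subset_trans (block_boundary_sub A_good jr).
    exact: subD1set.
  - move=> v vA; rewrite mate_id eqxx; apply: leq_trans (deg v vA).
    apply/subset_leq_card/subsetP => j; rewrite !inE => /andP[-> /andP[_]].
    by rewrite andTb.
have pA0 : #|pairs A A| = 0.
  by apply: eq_card0 => v; rewrite inE mate_id ltnn andbF.
have C_lt : (num_colorings k G)%:R < q ^+ #|G| *
    theta ^+ (3 * #|singles A (~: A)| + 5 * #|pairs A (~: A)|).
  have := card_Om R k_ge3 A_good; rewrite pA0 expr0 mulr1 => <-.
  rewrite (num_coloringsE R k_ge3 A_good) mulrC -ltr_pdivrMr ?ltr0n// -/(mean _ _).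
  apply: le_lt_trans (_ : _ <= mean Om (fun x => \prod_(j in reps A) cbrt (F j x))) _.
    by apply: le_mean => x _; apply: ler_prod => j _; rewrite /F cbrtX block_density_ge0/=.
  apply: lt_le_trans lt1 (le_trans le2 _).
  exact: prod_moments_le.
have th0 := edge_density_gt0 R k_ge3.
have cnt := cut_edge_count G_cubic mono_le1; rewrite pA0 add0n in cnt.
rewrite -(edge_density_chrom R k_ge3 cnt).
by rewrite ltrXn2r ?nnegrE ?mulr_ge0 ?exprn_ge0 ?(ltW th0) ?(ltW q_gt0).
Qed.

End Bipartite.

Local Close Scope ring_scope.

(** * Unions of copies of K_{3,3} *)

Local Notation K33 := (complete_bipartite 3 3).

Section Counting.

Lemma num_colorings_isomorphic (G H : sgraph) q :
  isomorphic G H -> num_colorings q G = num_colorings q H.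
Proof.
case=> f [g fK gK] fE; rewrite /num_colorings.
pose h (c : {ffun H -> 'I_q}) : {ffun G -> 'I_q} := [ffun u => c (f u)].
have h_inj : injective h.
  by move=> c c' /ffunP cc; apply/ffunP => u; have := cc (g u); rewrite !ffunE gK.
rewrite -(card_imset _ h_inj); apply: eq_card => c; rewrite inE; apply/idP/imsetP.
  move=> /forallP cP; exists [ffun w => c (g w)].
    rewrite inE; apply/forallP => u; apply/forallP => v; rewrite !ffunE.
    by have := forallP (cP (g u)) (g v); rewrite -fE !gK.
  by apply/ffunP => u; rewrite !ffunE fK.
case=> c'; rewrite inE => /forallP cP ->; apply/forallP => u; apply/forallP => v.
by rewrite !ffunE; have := forallP (cP (f u)) (f v); rewrite fE.
Qed.

Lemma num_colorings_copies k (H : sgraph) q :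
  num_colorings q (disjoint_copies k H) = num_colorings q H ^ k.
Proof.
rewrite /num_colorings -[X in _ = _ ^ X](card_ord k) -card_ffun_on.
pose h (F : {ffun 'I_k -> {ffun H -> 'I_q}}) : {ffun disjoint_copies k H -> 'I_q} :=
  [ffun p => F p.1 p.2].
have h_inj : injective h.
  move=> F F' /ffunP FF; apply/ffunP => i; apply/ffunP => u.
  by have := FF (i, u); rewrite !ffunE.
rewrite -(card_imset _ h_inj); apply: eq_card => c; rewrite inE; apply/idP/imsetP.
  move=> /forallP cP; exists [ffun i => [ffun u => c (i, u)]].
    apply/ffun_onP => i; rewrite inE; apply/forallP => u; apply/forallP => v.
    by have := forallP (cP (i, u)) (i, v); rewrite !ffunE /= /copies_edge eqxx.
  by apply/ffunP => -[i u]; rewrite !ffunE.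
case=> F /ffun_onP FP ->; apply/forallP => -[i u]; apply/forallP => -[j v].
rewrite !ffunE; apply/implyP => /andP[/eqP/= -> e].
by have := FP j; rewrite inE => /forallP/(_ u)/forallP/(_ v)/implyP; apply.
Qed.

Lemma num_colorings_K33 k :
  num_colorings k K33 = \sum_(a < k) \sum_(b < k) \sum_(c < k) free3 a b c ^ 3.
Proof.
pose h (p : 'I_k * 'I_k * 'I_k) : {ffun 'I_3 -> 'I_k} :=
  [ffun i : 'I_3 => nth p.1.1 [:: p.1.1; p.1.2; p.2] i].
pose o1 : 'I_3 := Ordinal (isT : 1 < 3); pose o2 : 'I_3 := Ordinal (isT : 2 < 3).
pose h' (u : {ffun 'I_3 -> 'I_k}) := (u ord0, u o1, u o2).
have hK : cancel h h' by case=> -[a b] c; rewrite /h' !ffunE.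
have h'K : cancel h' h.
  move=> u; apply/ffunP => -[[|[|[|]]]//= lt]; rewrite ffunE/=; congr (u _); exact: val_inj.
transitivity (\sum_(u : {ffun 'I_3 -> 'I_k}) free3 (u ord0) (u o1) (u o2) ^ 3); last first.
  rewrite (reindex h) /=; last by exists h' => ? _.
  rewrite pair_bigA/= pair_bigA/=; apply: eq_bigr => -[[a b] c] _.
  by rewrite !ffunE.
pose S := [set f : {ffun K33 -> 'I_k} | proper_coloring f].
pose F (u v : {ffun 'I_3 -> 'I_k}) : {ffun K33 -> 'I_k} :=
  [ffun x => match x with inl i => u i | inr i => v i end].
pose P (u v : {ffun 'I_3 -> 'I_k}) := [forall i, v i \notin u @: setT].
transitivity #|[set p | P p.1 p.2]|.
  pose H (p : {ffun 'I_3 -> 'I_k} * {ffun 'I_3 -> 'I_k}) := F p.1 p.2.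
  have H_inj : injective H.
    move=> [u v] [u' v'] /ffunP E; congr (_, _); apply/ffunP => i.
      by have := E (inl i); rewrite !ffunE.
    by have := E (inr i); rewrite !ffunE.
  rewrite /num_colorings -(card_imset _ H_inj); apply: eq_card => c; rewrite inE.
  apply/idP/imsetP => [/forallP cP|[[u v]]].
    exists ([ffun i => c (inl i)], [ffun i => c (inr i)]).
      rewrite inE; apply/forallP => i /=; apply/imsetP => -[j _]; rewrite !ffunE => E.
      by have := forallP (cP (inr i)) (inl j); rewrite /= E eqxx.
    by apply/ffunP => -[i|i]; rewrite !ffunE.
  rewrite inE => /forallP/= uv ->; apply/forallP => x; apply/forallP => y.
  have ne i j : u i != v j.
    by apply: contraNneq (uv j) => <-; apply/imsetP; exists i.
  by case: x y => [i|i] [j|j] //=; rewrite !ffunE/= ?ne// eq_sym ne.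
rewrite -sum1_card (eq_bigl (fun p => P p.1 p.2)) => [|p]; last by rewrite inE.
rewrite -(pair_big_dep predT P (fun _ _ => 1))/=; apply: eq_bigr => u _.
rewrite sum1_card /free3.
have -> : [set u ord0; u o1; u o2] = u @: setT.
  apply/setP => c; rewrite !inE; apply/idP/imsetP => [|[[[|[|[|]]]//= lt] _ ->]].
  - by case/orP => [/orP[]|] /eqP ->; [exists ord0|exists o1|exists o2].
  - by rewrite (_ : Ordinal lt = ord0) ?eqxx//; apply: val_inj.
  - by rewrite (_ : Ordinal lt = o1) ?eqxx ?orbT//; apply: val_inj.
  - by rewrite (_ : Ordinal lt = o2) ?eqxx ?orbT//; apply: val_inj.
rewrite -[X in _ = _ ^ X](card_ord 3) -card_ffun_on; apply: eq_card => v.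
apply/forallP/ffun_onP => vP i; have := vP i; by rewrite inE.
Qed.

Lemma num_colorings_K33R (R : realFieldType) k :
  ((num_colorings k K33)%:R = chrom_K33 k%:R :> R)%R.
Proof.
have := @sum_free3 R 'I_k; rewrite card_ord => <-.
rewrite num_colorings_K33 natr_sum; apply: eq_bigr => a _.
rewrite natr_sum; apply: eq_bigr => b _; rewrite natr_sum; apply: eq_bigr => c _.
by rewrite natrX.
Qed.

Lemma num_colorings_K33_2 : num_colorings 2 K33 = 2.
Proof.
apply/eqP; rewrite -(@eqr_nat rat) num_colorings_K33R /chrom_K33.
by apply/eqP; lra.
Qed.

Lemma num_colorings_union (G : sgraph) q : is_union_of_copies K33 G ->
  num_colorings q G ^ 6 = num_colorings q K33 ^ #|G|.
Proof.
case=> k iso; rewrite (num_colorings_isomorphic q iso) num_colorings_copies.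
have -> : #|G| = k * 6.
  case: iso => f fbij _; rewrite (bij_eq_card fbij) card_prod card_ord card_sum !card_ord.
  by [].
by rewrite -expnM.
Qed.

End Counting.

Section Twins.
Variables (G : sgraph) (A : {set G}).
Hypotheses (G_cubic : regular 3 G) (A_bip : bipartition A).

Definition twin_neighbours :=
  forall u v v' w : G, edge u v -> edge u v' -> edge v w -> edge v' w.

Let N (v : G) := [set w | edge v w].

Let cardN v : #|N v| = 3. Proof. exact: G_cubic. Qed.

Hypothesis twins : twin_neighbours.

Let N_twin u v v' : edge u v -> edge u v' -> N v = N v'.
Proof. by move=> e e'; apply/setP => w; rewrite !inE; apply/idP/idP; apply: (twins (u := u)). Qed.

Let nbr_ex (v : G) : exists w, edge v w.
Proof. by have /card_gt0P[w] : 0 < #|N v| by [rewrite cardN]; rewrite inE; exists w. Qed.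

Let nbr v := xchoose (nbr_ex v).
Let edge_nbr v : edge v (nbr v). Proof. exact: xchooseP. Qed.

(* The two colour classes of the copy of [K_{3,3}] containing [u]: the one on the
   side of [A], which labels the copy, and the one containing [u]. *)
Let label u := if u \in A then N (nbr u) else N u.
Let class u := N (nbr u).

Let u_class u : u \in class u. Proof. by rewrite inE edge_sym. Qed.

Let label_edge u v : edge u v -> label u = label v.
Proof.
move=> e; rewrite /label (A_bip e); case: (boolP (v \in A)) => vA /=; last first.
  exact: N_twin (edge_nbr u) e.
by apply: N_twin (edge_nbr v); rewrite edge_sym.
Qed.

Lemma twins_union : is_union_of_copies K33 G.
Proof.
pose labels := label @: [set: G].
have lab u : label u \in labels by apply: imset_f.
pose k := #|labels|; exists k.
have idx_lt u : index (label u) (enum labels) < k by rewrite /k cardE index_mem mem_enum.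
have pos_lt u : index u (enum (class u)) < 3.
  by rewrite -(cardN (nbr u)) cardE index_mem mem_enum.
pose side u (i : 'I_3) : 'I_3 + 'I_3 := if u \in A then inl i else inr i.
pose f (u : G) : disjoint_copies k K33 := (Ordinal (idx_lt u), side u (Ordinal (pos_lt u))).
have sideE u i v j : side u i = side v j -> (u \in A) = (v \in A) /\ i = j.
  by rewrite /side; case: (u \in A); case: (v \in A) => // -[->].
have idxE u v : Ordinal (idx_lt u) = Ordinal (idx_lt v) -> label u = label v.
  by case=> /(congr1 (nth set0 (enum labels))); rewrite !nth_index ?mem_enum.
have same_class u v : label u = label v -> (u \in A) = (v \in A) -> class u = class v.
  rewrite /label /class => + uv; rewrite -uv; case: ifP => // uA E.
  have e : edge v (nbr u) by have := edge_nbr u; have := E => /setP/(_ (nbr u)); rewrite !inE => ->.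
  exact: N_twin (e) (edge_nbr v) .
have f_inj : injective f.
  move=> u v fuv; have lE := idxE _ _ (congr1 fst fuv).
  have [uv /(congr1 val)/= pE] := sideE _ _ _ _ (congr1 snd fuv).
  have cE := same_class u v lE uv; move: pE; rewrite cE.
  by move/(congr1 (nth u (enum (class v)))); rewrite !nth_index// mem_enum// -cE.
have f_surj y : exists u, f u == y.
  case: y => b s.
  have [u0 bE] : exists u0, b = Ordinal (idx_lt u0).
    have : nth set0 (enum labels) b \in labels by rewrite -mem_enum mem_nth// -cardE.
    case/imsetP => u0 _ E; exists u0; apply: val_inj => /=.
    by rewrite -E index_uniq ?enum_uniq// -cardE.
  (* [u0] and its neighbour [nbr u0] have the same label and lie on opposite sides; one of them is
     on the side given by [s]. *)
  have [u1 [b1E [i sE]]] : exists u1, b = Ordinal (idx_lt u1) /\ exists i, s = side u1 i.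
    have lE : Ordinal (idx_lt (nbr u0)) = Ordinal (idx_lt u0).
      by apply: val_inj; rewrite /= (label_edge (edge_nbr u0)).
    rewrite /side; have := A_bip (edge_nbr u0); case: (boolP (u0 \in A)) => u0A nA;
      case: s => i.
    - by exists u0; split=> //; exists i; rewrite u0A.
    - by exists (nbr u0); split; [rewrite lE | exists i; rewrite (negPf (esym nA))].
    - exists (nbr u0); split; [by rewrite lE | exists i].
      by move: nA; case: (_ \in A).
    - by exists u0; split=> //; exists i; rewrite (negPf u0A).
  pose w := nth u1 (enum (class u1)) i.
  have iw : i < size (enum (class u1)) by rewrite -cardE cardN.
  have wc : w \in class u1 by rewrite -mem_enum mem_nth.
  have e : edge (nbr u1) w by move: wc; rewrite inE.
  have lE : label w = label u1 by rewrite -(label_edge e) (label_edge (edge_nbr u1)).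
  have sw : (w \in A) = (u1 \in A).
    by rewrite (A_bip (edge_nbr u1)); have := A_bip e; case: (w \in A); case: (_ \in A).
  have cE := same_class w u1 lE sw.
  exists w; rewrite b1E sE /f; apply/eqP; congr (_, _).
    by apply: val_inj; rewrite /= lE.
  have -> : side w =1 side u1 by move=> ?; rewrite /side sw.
  by congr side; apply: val_inj; rewrite /= cE index_uniq ?enum_uniq.
have [g fK gK] : bijective f.
  exists (fun y => xchoose (f_surj y)) => [u|y]; last exact/eqP/(xchooseP (f_surj y)).
  by apply: f_inj; apply/eqP; exact: (xchooseP (f_surj (f u))).
exists f; first by exists g.
have bipE u v i j : bip_edge (side u i) (side v j) = ((u \in A) != (v \in A)).
  by rewrite /side; case: (u \in A); case: (v \in A).
move=> u v; rewrite /= /copies_edge /= bipE.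
apply/andP/idP => [[/eqP/idxE lE uv]|e]; last first.
  split; last by rewrite (A_bip e); case: (v \in A).
  by apply/eqP/val_inj; rewrite /= (label_edge e).
wlog uA : u v lE uv / u \in A.
  move=> H; case: (boolP (u \in A)) => uA; first exact: H.
  rewrite edge_sym; apply: H => //; first by rewrite eq_sym.
  by move: uv; rewrite (negPf uA); case: (v \in A).
have vA : v \in A = false by move: uv; rewrite uA; case: (v \in A).
have := u_class u; rewrite /class; move: lE; rewrite /label uA vA => ->.
by rewrite inE edge_sym.
Qed.

End Twins.

Section TwoColors.
Variable G : sgraph.
Hypothesis G_cubic : regular 3 G.

(** A bipartite graph with [c] components has at most [2 ^ c] colourings. The neighbourhoods of two
    adjacent vertices are disjoint, so a component has at least six vertices, and one larger
    component makes the bound strict. *)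
Lemma two_colors : num_colorings 2 G ^ 6 < 2 ^ #|G| \/ is_union_of_copies K33 G.
Proof.
have [C0|C_gt0] := posnP (num_colorings 2 G); first by left; rewrite C0 exp0n// expn_gt0.
have /card_gt0P[x0] := C_gt0; rewrite inE => /forallP x0P.
have neq_col (x : {ffun G -> 'I_2}) u v : proper_coloring x -> edge u v -> x u != x v.
  by move=> /forallP/(_ u)/forallP/(_ v)/implyP; apply.
have x0_proper : proper_coloring x0 by apply/forallP.
pose A := [set v | x0 v == ord0].
have A_bip : bipartition A.
  move=> u v /(neq_col _ _ _ x0_proper); rewrite !inE.
  by case: (x0 u) (x0 v) => [[|[|//]] ?] [[|[|//]] ?].
pose e := @edge G; have e_sym : connect_sym e := sym_connect_sym (@edge_sym G).
pose Rt := [set v | fingraph.root e v == v]; pose K r := [set v | fingraph.root e v == r].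
have C_le : num_colorings 2 G <= 2 ^ #|Rt|.
  rewrite -card_powerset /num_colorings.
  (* With two colours, agreement with [x0] is constant on a component, so its value at the roots
     determines [x]. *)
  pose h (x : {ffun G -> 'I_2}) := [set r in Rt | x r == x0 r].
  rewrite -(card_in_imset (f := h)) => [|x y]; last first.
    rewrite !inE => xP yP /setP xy; apply/ffunP => v.
    have inv (z : {ffun G -> 'I_2}) : proper_coloring z ->
        forall w, connect e v w -> (z v == x0 v) = (z w == x0 w).
      move=> zP w /connectP[p]; elim: p v => [|a p IH] v /=; first by move=> _ ->.
      move=> /andP[va pa] /(IH a pa) <-.
      have := neq_col _ _ _ zP va; have := neq_col _ _ _ x0_proper va.
      case: (x0 v) (x0 a) (z v) (z a) => [[|[|//]] ?] [[|[|//]] ?] [[|[|//]] ?] [[|[|//]] ?] //.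
    have := xy (fingraph.root e v); rewrite !inE root_root// eqxx/=.
    rewrite -!inv ?connect_root//.
    case: (x v) (y v) (x0 v) => [[|[|//]] ?] [[|[|//]] ?] [[|[|//]] ?] //= _;
      exact: val_inj.
  apply/subset_leq_card/subsetP => _ /imsetP[x _ ->]; rewrite inE.
  by apply/subsetP => r; rewrite inE => /andP[].
pose N (v : G) := [set w | edge v w].
have cardN v : #|N v| = 3 by exact: G_cubic.
have side (u v w : G) : edge u w -> edge v w -> (u \in A) = (v \in A).
  by move=> /A_bip -> /A_bip ->.
have disjN (u v : G) : edge u v -> [disjoint N u & N v].
  move=> uv; apply/pred0P => w /=; rewrite !inE; apply/negP => /andP[uw vw].
  by have := side _ _ _ uw vw; rewrite (A_bip _ _ uv); case: (v \in A).
have cardNN (u v : G) : edge u v -> #|N u :|: N v| = 6.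
  by move=> uv; rewrite cardsU (disjoint_setI0 (disjN u v uv)) cards0 !cardN.
have subK (u v : G) : edge u v -> N u :|: N v \subset K (fingraph.root e u).
  move=> uv; apply/subsetP => w uw.
  suff c : connect e u w by rewrite inE; apply/eqP/esym/(fingraph.rootP e_sym).
  move: uw; rewrite !inE => /orP[] ew; first exact: connect1.
  by apply: (connect_trans (connect1 uv)); exact: connect1.
have nbr_ex (v : G) : exists w, edge v w.
  by have /card_gt0P[w] : 0 < #|N v| by [rewrite cardN]; rewrite inE; exists w.
have cardK u : 6 <= #|K (fingraph.root e u)|.
  by have [v uv] := nbr_ex u; rewrite -(cardNN u v uv) subset_leq_card// subK.
have cardG : #|G| = \sum_(r in Rt) #|K r|.
  rewrite -sum1_card (partition_big (fingraph.root e) (mem Rt)) /=; last first.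
    by move=> v _; rewrite inE root_root.
  by apply: eq_bigr => r _; rewrite sum1dep_card.
have K6 r : r \in Rt -> 6 <= #|K r| by rewrite inE => /eqP <-.
have [twin|ntwin] := boolP [forall r in Rt, #|K r| == 6].
  right; apply: (twins_union G_cubic A_bip) => u v v' w uv uv' vw.
  (* A component of six vertices is exhausted by [N u] and [N v]; as [N v'] is disjoint from [N u],
     it must be [N v]. *)
  have KE : K (fingraph.root e u) = N u :|: N v.
    apply/esym/eqP; rewrite eqEcard subK// cardNN//.
    have ru : fingraph.root e u \in Rt by rewrite inE root_root.
    by rewrite (eqP (forall_inP twin _ ru)).
  suff NE : N v' = N v by move/setP/(_ w): NE; rewrite !inE vw.
  apply/eqP; rewrite eqEcard !cardN leqnn andbT; apply/subsetP => z zv'.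
  have : z \in K (fingraph.root e u) by rewrite (subsetP (subK u v' uv'))// inE zv' orbT.
  rewrite KE inE => /orP[zu|//]; have /pred0P/(_ z) := disjN u v' uv'.
  by rewrite /= zu zv'.
left; apply: (@leq_ltn_trans (2 ^ (6 * #|Rt|))).
  by rewrite mulnC expnM leq_exp2r.
rewrite ltn_exp2l// cardG mulnC -sum_nat_const.
have /forall_inPn[r rR rn] := ntwin.
rewrite (bigD1 r)//= [X in _ < X](bigD1 r)//= -addSn leq_add//.
  by rewrite ltn_neqAle eq_sym rn K6.
by apply: leq_sum => r' /andP[r'R _]; exact: K6.
Qed.

End TwoColors.


(** * From a good cut to the dichotomy: strict inequality or a union of copies *)

Lemma mate_setC (G : sgraph) (A : {set G}) v : mate (~: A) v = mate A v.
Proof. by rewrite /mate; rewrite (eq_pick (mono_edge_setC A v)). Qed.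

Lemma bipartition_setC (G : sgraph) (A : {set G}) : bipartition A -> bipartition (~: A).
Proof. by move=> bA u v /bA; rewrite !inE => ->. Qed.

Lemma good_cut_bipartite (G : sgraph) (A : {set G}) : good_cut A ->
  #|pairs A A| = 0 -> #|pairs (~: A) (~: A)| = 0 -> bipartition A.
Proof.
move=> gA pA pB u v e; have le1 := proj1 gA.
have nopair w : w \notin pairs A A :|: pairs (~: A) (~: A).
  by rewrite (cards0_eq pA) (cards0_eq pB) !inE.
apply: contraTeq isT => uv; rewrite /=; apply/negP => _.
have muv : mono_edge A u v by rewrite /mono_edge e; move: uv; case: (u \in A); case: (v \in A).
have mE := mate_mono_edge le1 muv.
have uvn : u != v by apply: contraTneq e => ->; rewrite edge_irrefl.
have mvE : mate A v = u by apply: (mate_mono_edge le1); rewrite mono_edge_sym.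
have := nopair u; have := nopair v; rewrite !inE !mate_setC mE mvE.
have := muv; rewrite /mono_edge => /andP[_ /eqP ->].
case: ltngtP => [||/val_inj/enum_rank_inj E]; try by case: (v \in A).
by rewrite E eqxx in uvn.
Qed.

Lemma many_colors (R : realType) (G : sgraph) q : (3 <= q)%N -> regular 3 G ->
  (num_colorings q G ^ 6 < num_colorings q K33 ^ #|G|)%N \/ is_union_of_copies K33 G.
Proof.
move=> q3 G3; have natE : (num_colorings q G ^ 6 < num_colorings q K33 ^ #|G|)%N =
   ((num_colorings q G)%:R ^+ 6 < chrom_K33 q%:R ^+ #|G| :> R)%R.
  by rewrite -num_colorings_K33R -!natrX ltr_nat.
rewrite natE.
have [A gA] := exists_good_cut G3.
have [pA|pA] := posnP #|pairs A A|; last by left; exact: num_colorings_cut_lt gA pA.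
have [pB|pB] := posnP #|pairs (~: A) (~: A)|; last first.
  by left; exact: num_colorings_cut_lt (good_cut_setC gA) pB.
have bA := good_cut_bipartite gA pA pB.
have [twin|/forallPn[u /forallPn[v /forallPn[v' /forallPn[w]]]]] :=
  boolP [forall u : G, forall v : G, forall v' : G, forall w : G,
    [&& edge u v, edge u v' & edge v w] ==> edge v' w].
  right; apply: (twins_union G3 bA) => u v v' w uv uv' vw.
  by have /forallP/(_ v)/forallP/(_ v')/forallP/(_ w) := forallP twin u; rewrite uv uv' vw.
rewrite negb_imply => /andP[/and3P[uv uv' vw] v'w]; left.
have [uA|uA] := boolP (u \in A); first exact: num_colorings_bipartite_lt bA _ _ _ _ uA uv uv' vw v'w.
apply: (num_colorings_bipartite_lt R q3 G3 (bipartition_setC bA) _ uv uv' vw v'w).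
by rewrite inE.
Qed.


Local Open Scope ring_scope.

Theorem corollary1 (R : realType) (G : sgraph) (q : nat)
    (G_nonempty : (0 < #|G|)%N) (G_cubic : regular 3 G) (q_ge2 : (2 <= q)%N) :
  let lhs : R := powR (num_colorings q G)%:R (#|G|%:R^-1) in
  let rhs : R := powR (num_colorings q (complete_bipartite 3 3))%:R (6%:R^-1) in
  lhs <= rhs /\ (lhs = rhs <-> is_union_of_copies (complete_bipartite 3 3) G).
Proof.
move=> lhs rhs.
have dich : (num_colorings q G ^ 6 < num_colorings q K33 ^ #|G|)%N \/ is_union_of_copies K33 G.
  case: (ltngtP q 2) => [||->]; first by rewrite ltnNge q_ge2.
    by move=> q3; exact: (many_colors R).
  by rewrite num_colorings_K33_2; exact: two_colors.
have n0 : (#|G|%:R : R) != 0 by rewrite pnatr_eq0 -lt0n.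
(* This power clears both roots, and the comparison becomes one of natural numbers. *)
have lhsX : lhs ^+ (6 * #|G|) = (num_colorings q G ^ 6)%:R.
  rewrite /lhs -powR_mulrn ?powR_ge0// -powRrM natrM mulrCA mulVf// mulr1.
  by rewrite powR_mulrn// natrX.
have rhsX : rhs ^+ (6 * #|G|) = (num_colorings q K33 ^ #|G|)%:R.
  rewrite /rhs -powR_mulrn ?powR_ge0// -powRrM natrM mulrA mulVf ?pnatr_eq0// mul1r.
  by rewrite powR_mulrn// natrX.
have N0 : (0 < 6 * #|G|)%N by rewrite muln_gt0.
have lhs0 : 0 <= lhs by exact: powR_ge0.
have rhs0 : 0 <= rhs by exact: powR_ge0.
case: dich => [lt|union].
  have lr : lhs < rhs by rewrite -(ltr_pXn2r N0)// lhsX rhsX ltr_nat.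
  split; first exact: ltW.
  split=> [E|/num_colorings_union E]; first by rewrite E ltxx in lr.
  by rewrite (E q) ltnn in lt.
have E : lhs = rhs.
  apply/eqP; rewrite -(eqrXn2 N0)// lhsX rhsX.
  by rewrite (num_colorings_union q union).
by split=> //; rewrite E.
Qed.
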